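(* Let $0\le\delta\le 3/956$ and let $\mathcal{I}$ be a $\delta$-ONI instance with $n$ agents such that $|N^1_1|> n\left(\frac14-\delta\right)/\left(\frac14+\frac{\delta}{3}\right)$. Then Algorithm $\mathtt{approxMMS2}(\mathcal{I},\delta)$ (for every resolution of its arbitrary choices) returns a $\left(\frac34+\delta\right)$-MMS allocation of $\mathcal{I}$.
   Context: An instance has agents $N=[n]$, goods $M$, additive valuations $v_i:2^M\to\mathbb{R}_{\ge0}$; $\mathrm{MMS}^d_v(S)$ is the max over partitions of $S$ into $d$ bundles of the minimum bundle value, $\mathrm{MMS}_i=\mathrm{MMS}^n_{v_i}(M)$; an allocation (disjoint bundles $A_i$) is $\beta$-MMS if $v_i(A_i)\ge\beta\mathrm{MMS}_i$ for all $i$. Ordered: $M=[m]$ and $v_i(1)\ge\dots\ge v_i(m)$ for all $i$. Normalized: every agent $i$ has an MMS partition all of whose $n$ bundles have value exactly $1$ to $i$. For an ordered instance with $n$ agents and threshold $\alpha$: $R^\alpha_2$ is applicable if some agent $i$ has $v_i(\{2n-1,2n,2n+1\})\ge\alpha$, and applying it gives this set to such an agent and removes agent and goods; $R^\alpha_3$ likewise with $\{3n-2,3n-1,3n,3n+1\}$. The instance is $\alpha$-irreducible if for every agent $i$: $v_i(1)<\alpha$, $v_i(\{2n-1,2n,2n+1\})<\alpha$, $v_i(\{3n-2,\dots,3n+1\})<\alpha$, $v_i(\{1,2n+1\})<\alpha$; it is $\delta$-ONI if ordered, normalized and $(3/4+\delta)$-irreducible. Goods with index larger than the number of goods, when referred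 to, are dummy goods of value $0$. For the input instance let $B_k=\{k,2n-k+1\}$ ($k\in[n]$), $N^1=\{i:v_i(B_k)\le1\ \forall k\}$, $N^2=N\setminus N^1$, $N^1_1=\{i\in N^1:v_i(2n+1)\ge\frac14-5\delta\}$, $N^1_2=N^1\setminus N^1_1$; these sets are fixed throughout. Algorithm $\mathtt{approxMMS2}(\mathcal{I},\delta)$, with $\alpha=3/4+\delta$ and ''priority'' meaning an agent of $N^1_2\cup N^2$ is chosen whenever one qualifies: Phase 1: while some remaining agent $i$ and remaining bag $B_k$ have $v_i(B_k)\ge\alpha$, give such a bag to such an agent (priority) and remove both. After every removal, the remaining goods are re-indexed $1,2,\dots$ in decreasing order of value (common to all agents). Phase 2: while some remaining agent $i$ has $v_i(\{1,2\})\ge\alpha$, give $\{1,2\}$ to such an agent (priority) and remove them. Phase 3: while $R^\alpha_2$ or $R^\alpha_3$ is applicable (w.r.t. the current number of agents), apply the one with the smaller index. Phase 4: let $n'$ be the current number of agents, set $C_k=\{k,2n'-k+1,2n'+k\}$ for $k\in[n']$; for $k=1,\dots,n'$: while no remaining agent values $C_k$ at least $\alpha$, add to $C_k$ an arbitrary remaining good outside $[3n']$; then give $C_k$ to a remaining agent $i$ with $v_i(C_k)\ge\alpha$ (priority) and remove them. *)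

(* Defs.v *)
(* Goods are natural numbers 1..m (original indices of the
   ordered input instance), agents are natural numbers 1..n.
   v i j = value of good j for agent i. *)
From mathcomp Require Import all_boot all_order all_algebra.
Set Implicit Arguments. Unset Strict Implicit. Unset Printing Implicit Defensive.
Import Order.TTheory GRing.Theory Num.Theory.

(* remaining agents, remaining goods (original indices, kept in increasing
   order, i.e. in decreasing order of value), current partial allocation *)
Record state := State {
  st_agents : seq nat;
  st_goods  : seq nat;
  st_alloc  : nat -> seq nat }.

Inductive outcome := Success of (nat -> seq nat) | Failure.

Definition give (st : state) (i : nat) (S : seq nat) : state :=
  State (rem i (st_agents st))
        [seq g <- st_goods st | g \notin S]
        (fun j => if j == i then S else st_alloc st j).

(* position p (1-indexed) in the current ordering of the remaining goods G *)
Definition inr (G : seq nat) (p : nat) : bool := (0 < p) && (p <= size G).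
Definition posg (G : seq nat) (p : nat) : nat := nth 0 G p.-1.
(* the real goods at positions ps (positions beyond size G are dummy goods of
   value 0, and are simply dropped) *)
Definition baggoods (G : seq nat) (ps : seq nat) : seq nat :=
  [seq posg G p | p <- ps & inr G p].

Section Defs.
Variable R : realFieldType.
Local Open Scope ring_scope.
Variable v : nat -> nat -> R.

(* additive valuation of a set of goods (given as a duplicate-free list) *)
Definition vS (i : nat) (S : seq nat) : R := \sum_(j <- S) v i j.

Definition bagval (i : nat) (G : seq nat) (ps : seq nat) : R :=
  vS i (baggoods G ps).

(* a partition of S into d bundles : each good j of S goes to bundle P j < d *)
Definition is_partition (d : nat) (S : seq nat) (P : nat -> nat) : Prop :=
  forall j, j \in S -> (P j < d)%N.
Definition bundle (P : nat -> nat) (S : seq nat) (k : nat) : seq nat :=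
  [seq j <- S | P j == k].

Definition is_MMS_partition (val : seq nat -> R) (d : nat) (S : seq nat)
    (P : nat -> nat) : Prop :=
  is_partition d S P /\
  forall P', is_partition d S P' ->
    exists2 k, (k < d)%N &
      forall k', (k' < d)%N -> val (bundle P' S k) <= val (bundle P S k').

Definition is_MMS_value (val : seq nat -> R) (d : nat) (S : seq nat) (x : R)
  : Prop :=
  exists P, is_MMS_partition val d S P /\
    (forall k, (k < d)%N -> x <= val (bundle P S k)) /\
    exists2 k, (k < d)%N & val (bundle P S k) = x.

Variables (n m : nat).

Definition goodsM : seq nat := iota 1 m.
Definition agentsN : seq nat := iota 1 n.

Definition nonneg_vals : Prop :=
  forall i j, i \in agentsN -> j \in goodsM -> 0 <= v i j.

Definition ordered : Prop :=
  forall i j1 j2, i \in agentsN -> (1 <= j1)%N -> (j1 <= j2)%N -> (j2 <= m)%N ->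
    v i j2 <= v i j1.

Definition normalized : Prop :=
  forall i, i \in agentsN ->
    exists P, is_MMS_partition (vS i) n goodsM P /\
      forall k, (k < n)%N -> vS i (bundle P goodsM k) = 1.

(* value of the good(s) with the given indices of the input instance
   (indices > m are dummy goods of value 0) *)
Definition ival (i : nat) (ps : seq nat) : R := bagval i goodsM ps.

Definition irreducible (alpha : R) : Prop :=
  forall i, i \in agentsN ->
    [/\ ival i [:: 1%N] < alpha,
        ival i [:: (2 * n).-1; 2 * n; (2 * n).+1]%N < alpha,
        ival i [:: (3 * n - 2); (3 * n).-1; 3 * n; (3 * n).+1]%N < alpha
      & ival i [:: 1; (2 * n).+1]%N < alpha].

Definition ONI (delta : R) : Prop :=
  [/\ nonneg_vals, ordered, normalized & irreducible (3 / 4 + delta)].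

Definition Bk (k : nat) : seq nat := [:: k; (2 * n - k).+1]%N.

Definition inN1 (i : nat) : bool :=
  all (fun k => ival i (Bk k) <= 1) (iota 1 n).

Definition N11 (delta : R) : seq nat :=
  [seq i <- agentsN | inN1 i && (1 / 4 - 5 * delta <= ival i [:: (2 * n).+1]%N)].

Definition is_allocation (A : nat -> seq nat) : Prop :=
  (forall i, i \in agentsN -> uniq (A i) /\ {subset A i <= goodsM}) /\
  (forall i i', i \in agentsN -> i' \in agentsN -> i != i' ->
     forall g, g \in A i -> g \notin A i').

Definition is_beta_MMS (beta : R) (A : nat -> seq nat) : Prop :=
  forall i, i \in agentsN -> forall x, is_MMS_value (vS i) n goodsM x ->
    beta * x <= vS i (A i).

Section Algo.
Variables (alpha : R) (Np : seq nat). (* Np = N^1_1 (non-priority agents) *)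

Definition prio (val : nat -> R) (A : seq nat) (i : nat) : Prop :=
  i \in Np -> forall i', i' \in A -> i' \notin Np -> val i' < alpha.

(* Phase 1: the bags B_k (fixed goods of the input instance);
   RB = indices k of the bags not yet given *)
Inductive phase1 : seq nat -> state -> state -> Prop :=
| p1_step RB st i k st' :
    i \in st_agents st -> k \in RB ->
    alpha <= ival i (Bk k) ->
    prio (fun i' => ival i' (Bk k)) (st_agents st) i ->
    phase1 (rem k RB) (give st i (baggoods goodsM (Bk k))) st' ->
    phase1 RB st st'
| p1_stop RB st :
    (forall i k, i \in st_agents st -> k \in RB -> ival i (Bk k) < alpha) ->
    phase1 RB st st.

Inductive phase2 : state -> state -> Prop :=
| p2_step st i st' :
    i \in st_agents st ->
    alpha <= bagval i (st_goods st) [:: 1; 2]%N ->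
    prio (fun i' => bagval i' (st_goods st) [:: 1; 2]%N) (st_agents st) i ->
    phase2 (give st i (baggoods (st_goods st) [:: 1; 2]%N)) st' ->
    phase2 st st'
| p2_stop st :
    (forall i, i \in st_agents st -> bagval i (st_goods st) [:: 1; 2]%N < alpha) ->
    phase2 st st.

Definition R2pos (k : nat) : seq nat := [:: (2 * k).-1; 2 * k; (2 * k).+1]%N.
Definition R3pos (k : nat) : seq nat :=
  [:: 3 * k - 2; (3 * k).-1; 3 * k; (3 * k).+1]%N.

Inductive phase3 : state -> state -> Prop :=
| p3_R2 st i st' :
    i \in st_agents st ->
    alpha <= bagval i (st_goods st) (R2pos (size (st_agents st))) ->
    phase3 (give st i (baggoods (st_goods st) (R2pos (size (st_agents st))))) st' ->
    phase3 st st'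
| p3_R3 st i st' :
    (forall i', i' \in st_agents st ->
        bagval i' (st_goods st) (R2pos (size (st_agents st))) < alpha) ->
    i \in st_agents st ->
    alpha <= bagval i (st_goods st) (R3pos (size (st_agents st))) ->
    phase3 (give st i (baggoods (st_goods st) (R3pos (size (st_agents st))))) st' ->
    phase3 st st'
| p3_stop st :
    (forall i, i \in st_agents st ->
        bagval i (st_goods st) (R2pos (size (st_agents st))) < alpha /\
        bagval i (st_goods st) (R3pos (size (st_agents st))) < alpha) ->
    phase3 st st.

(* Phase 4: bag filling.  n4 = number of agents and G4 = ordering of the
   remaining goods at the start of phase 4; C_k = {k, 2n4-k+1, 2n4+k}
   w.r.t. that ordering; goods "outside [3 n4]" are those not among the first
   3 n4 goods of G4. *)
Section Phase4.
Variables (n4 : nat) (G4 : seq nat).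
Definition Cbase (k : nat) : seq nat :=
  baggoods G4 [:: k; (2 * n4 - k).+1; 2 * n4 + k]%N.
Definition low4 : seq nat := take (3 * n4) G4.

Inductive phase4 : nat -> seq nat -> state -> outcome -> Prop :=
| p4_end k C st : (n4 < k)%N -> phase4 k C st (Success (st_alloc st))
| p4_fill k C st g out :
    (k <= n4)%N ->
    (forall i, i \in st_agents st -> vS i C < alpha) ->
    g \in st_goods st -> g \notin low4 -> g \notin C ->
    phase4 k (rcons C g) st out ->
    phase4 k C st out
| p4_fail k C st :
    (k <= n4)%N ->
    (forall i, i \in st_agents st -> vS i C < alpha) ->
    (forall g, g \in st_goods st -> g \notin low4 -> g \in C) ->
    phase4 k C st Failure
| p4_give k C st i out :
    (k <= n4)%N ->
    i \in st_agents st -> alpha <= vS i C ->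
    prio (fun i' => vS i' C) (st_agents st) i ->
    phase4 k.+1 (Cbase k.+1) (give st i C) out ->
    phase4 k C st out.
End Phase4.
End Algo.

Definition init_state : state := State agentsN goodsM (fun _ => [::]).

(* out is a possible outcome of approxMMS2(I, delta), for some resolution of
   the arbitrary choices *)
Definition approxMMS2 (delta : R) (out : outcome) : Prop :=
  let alpha := 3 / 4 + delta in
  let Np := N11 delta in
  exists st1 st2 st3,
    [/\ phase1 alpha Np (iota 1 n) init_state st1,
        phase2 alpha Np st1 st2,
        phase3 alpha st2 st3
      & phase4 alpha Np (size (st_agents st3)) (st_goods st3)
               1 (Cbase (size (st_agents st3)) (st_goods st3) 1) st3 out].

End Defs.

(* Main.v *)
Require Import Defs.
From mathcomp Require Import all_boot all_order all_algebra.
From mathcomp Require Import zify ring lra.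
Import Order.TTheory GRing.Theory Num.Theory.
Set Implicit Arguments.
Unset Strict Implicit.
Unset Printing Implicit Defensive.
Local Open Scope ring_scope.

(** The algorithm can only go wrong in phase 4, when a bag cannot be filled; some
    agent [i] is then still there.  Measure values in units of [(1/4 + delta/3)/60]:
    the threshold becomes [180], the value of a bundle of the MMS partition of [i]
    becomes [240 - eta] with [0 <= eta <= 1], and [1/4 - 5 delta] becomes
    [60 - 4 eta >= 56].  All goods lie in bags, and we contradict the total value
    [(240 - eta) n].

    If [i] is in N^1_1, then the goods [1..2n] are worth at least [56] and at most
    [124].  Let [k] be the first bag [C_k] of phase 4 whose three initial goods are
    worth less than [180], [t] the value of the third and [X] of the second of them,
    so that [X < 90 - t/2].  If [t] is close to [60] or [X] is close to [90], the
    goods are re-weighted by a step function for which every bundle of the MMS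
    partition weighs at least a constant [c] (220 or 6), while every bag weighs at
    most [c] up to a defect of [C_1] that is outweighed by the unfinished bag.
    Otherwise one compares the value of each bag of phases 2, 3 and 4 with
    [240 - eta - lam (180 - Y)], where [Y] is the value of the corresponding pair
    among the first [2n'] goods and [lam = 9/68]: after phase 1 these pairs are worth
    less than [180] on average, and a bag of phase 2, worth up to [248], makes the
    remaining average drop.

    If [i] is not in N^1_1, there are [p < eta n / 60] such agents, and because of
    the priorities at most [p] bags of phases 1 and 2 are worth [180] or more to [i].
    If good [2n+1] is worth less than [tau = 60 - 4 eta], phases 3 and 4 use up at
    most [180 + tau] per bag, which is too little in total.  Otherwise some [B_k] is
    worth more than 1, hence the goods [1..n+1] are worth more than [90]; phases 1
    and 2 must have separated them, so that nearly all bags were given in phase 1 and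
    are worth less than [180]. *)

(** * Lists of values and the reductions of phase 3 *)

Definition cut (T : Type) (q l : nat) (s : seq T) : seq T :=
  take q s ++ drop (q + l) s.

Section RealLists.
Variable R : realFieldType.
Implicit Types (s : seq R) (psi : R -> R).

(** Positions beyond the end of the list read as 0, like dummy goods, so this also forces all values
    to be nonnegative. *)
Definition desc s := forall p q, (p <= q)%N -> s`_q <= s`_p.

Lemma desc_ge0 s p : desc s -> 0 <= s`_p.
Proof.
move=> ds; have := ds p (p + size s)%N (leq_addr _ _).
by rewrite [s`_(p + _)]nth_default ?leq_addl.
Qed.

Lemma nth_cut q l s p :
  (cut q l s)`_p = if (p < q)%N then s`_p else s`_(p + l).
Proof.
rewrite nth_cat size_take; case: (ltnP q (size s)) => hq.
  case: ifP => hp; first by rewrite nth_take.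
  by rewrite nth_drop; congr (s`_ _); lia.
rewrite take_oversize // drop_oversize; last by lia.
rewrite nth_nil; case: (ltnP p (size s)) => hs; first by rewrite ifT //; lia.
by rewrite [s`_p]nth_default // [s`_(p + l)]nth_default ?if_same // (leq_trans hs) ?leq_addr.
Qed.

Lemma desc_cut q l s : desc s -> desc (cut q l s).
Proof.
move=> ds p p' hp; rewrite !nth_cut; case: ifP; case: ifP => h1 h2; try lia.
- exact: ds.
- by apply: ds; lia.
- by apply: ds; lia.
Qed.

Lemma sum_take psi s l : psi 0 = 0 ->
  \sum_(y <- take l s) psi y = \sum_(p < l) psi s`_p.
Proof.
move=> psi0; elim: s l => [|y s IH] [|l] /=; rewrite ?big_nil ?big_ord0 //.
  by rewrite big1 // => p _; rewrite nth_nil.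
by rewrite big_cons IH big_ord_recl.
Qed.

Lemma sum_cut psi q l s : psi 0 = 0 ->
  \sum_(y <- s) psi y =
  \sum_(y <- cut q l s) psi y + \sum_(p < l) psi s`_(q + p).
Proof.
move=> psi0.
have <- : \sum_(y <- take l (drop q s)) psi y = \sum_(p < l) psi s`_(q + p).
  by rewrite sum_take //; apply: eq_bigr => p _; rewrite nth_drop.
rewrite -{1}(cat_take_drop q s) -{1}(cat_take_drop l (drop q s)) !big_cat /=.
by rewrite drop_drop [(l + q)%N]addnC addrCA addrC.
Qed.

Definition psum psi s l := \sum_(p < l) psi s`_p.

Lemma eq_psum psi s s' l :
  (forall p, (p < l)%N -> s`_p = s'`_p) -> psum psi s l = psum psi s' l.
Proof. by move=> h; apply: eq_bigr => p _; rewrite h. Qed.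

(** Position [j] is matched with its mirror image among the first [2 * n], as in the bags [B_k] and
    in the first two goods of [C_k]. *)
Lemma sum_fold2 (g : nat -> R) n :
  \sum_(p < 2 * n) g p = \sum_(j < n) (g j + g (2 * n - j.+1)%N).
Proof.
rewrite big_split /= -(big_mkord xpredT g) (big_cat_nat _ (n := n)) //=; last lia.
rewrite big_mkord; congr (_ + _).
rewrite -{1}[n]add0n big_addn big_rev_mkord.
have -> : (2 * n - n - 0 = n)%N by lia.
by apply: eq_bigr => j _; congr g; have := ltn_ord j; lia.
Qed.

(* [shrink n s n' s'] : what one agent who survives phase 3 sees of it.  The
   reduction R_3 is only applied when R_2 is not applicable to the agent. *)
Inductive shrink : nat -> seq R -> nat -> seq R -> Prop :=
| shrink_refl n s : shrink n s n s
| shrink_R2 n s n' s' :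
    shrink n.+1 (cut (2 * n.+1) 3 s) n' s' -> shrink n.+2 s n' s'
| shrink_R3 n s n' s' :
    s`_(2 * n.+1) + s`_(2 * n.+1).+1 + s`_(2 * n.+1).+2 < 180 ->
    shrink n.+1 (cut (3 * n.+1) 4 s) n' s' -> shrink n.+2 s n' s'.

Lemma shrink_le n s n' s' : shrink n s n' s' -> (n' <= n)%N.
Proof. by elim=> //; lia. Qed.

Lemma shrink_gt0 n s n' s' : shrink n s n' s' -> (0 < n)%N -> (0 < n')%N.
Proof. by elim=> // *; auto. Qed.

(** A reduction that leaves [n.+1] agents cuts no earlier than position [2 * n.+1], and afterwards
    the number of agents only decreases. *)
Lemma shrink_prefix n s n' s' : shrink n s n' s' ->
  forall p, (p < 2 * n')%N -> s'`_p = s`_p.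
Proof.
elim=> {n s n' s'} // n s n' s' => [|_] h IH p hp; rewrite (IH _ hp) nth_cut ifT //.
  by have := shrink_le h; lia.
by have := shrink_le h; lia.
Qed.

Lemma shrink_desc n s n' s' : shrink n s n' s' -> desc s -> desc s'.
Proof. by elim=> // *; auto using desc_cut. Qed.

(** R_2 removes three earlier goods, so the same good becomes the last of the new first [3 n]; R_3
    cuts just behind the new place, where a good at least as large stands. *)
Lemma shrink_third n s n' s' : shrink n s n' s' -> desc s -> (0 < n)%N ->
  s`_(3 * n).-1 <= s'`_(3 * n').-1.
Proof.
elim=> {n s n' s'} // n s n' s' => [|_] h IH ds _; apply: le_trans (IH _ _) => //;
  try exact: desc_cut; rewrite nth_cut; case: ifP => hp; apply: ds; lia.
Qed.

(** A potential that no single reduction decreases does not decrease in phase 3. The final bounds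
    [X] and [t] hold at every step because the front of the list is untouched and the last of the
    first [3 n] goods never gets smaller; [L] bounds the first [2 n] goods from below. *)
Lemma shrink_potential (F : nat -> seq R -> R) (X t L : R) n s n' s' :
  shrink n s n' s' -> desc s -> (0 < n)%N -> s`_0 + s`_1 < 180 ->
  L <= s`_(2 * n).-1 -> s'`_(2 * n').-1 <= X -> s'`_(3 * n').-1 <= t ->
  (forall n s, desc s -> s`_0 + s`_1 < 180 ->
     s`_(2 * n.+1) <= X -> L <= s`_(2 * n.+1).+1 ->
     F n.+2 s <= F n.+1 (cut (2 * n.+1) 3 s)) ->
  (forall n s, desc s -> s`_0 + s`_1 < 180 ->
     s`_(2 * n.+1) <= X -> L <= s`_(2 * n.+1).+1 -> s`_(3 * n.+1) <= t ->
     s`_(2 * n.+1) + s`_(2 * n.+1).+1 + s`_(2 * n.+1).+2 < 180 ->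
     F n.+2 s <= F n.+1 (cut (3 * n.+1) 4 s)) ->
  F n s <= F n' s'.
Proof.
move=> H; elim: H L => {n s n' s'} // n s n' s' => [|hR] h IH L ds _ h01 hL hX ht h2 h3;
  have n'gt0 : (0 < n')%N by apply: shrink_gt0 h _.
- have hX' : s`_(2 * n.+1) <= X.
    apply: le_trans hX.
    rewrite (shrink_prefix h) ?nth_cut ?ifT; try by have := shrink_le h; lia.
    by apply: ds; have := shrink_le h; lia.
  apply: le_trans (IH L _ _ _ _ _ _ h2 h3) => //; first 1 last.
  + exact: desc_cut.
  + by rewrite !nth_cut !ifT //; lia.
  + by rewrite nth_cut ifT; [apply: le_trans hL _; apply: ds; lia|lia].
  + by apply: h2 => //; apply: le_trans hL _; apply: ds; lia.
- have hX' : s`_(2 * n.+1) <= X.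
    apply: le_trans hX.
    rewrite (shrink_prefix h) ?nth_cut ?ifT; try by have := shrink_le h; lia.
    by apply: ds; have := shrink_le h; lia.
  apply: le_trans (IH L _ _ _ _ _ _ h2 h3) => //; first 1 last.
  + exact: desc_cut.
  + by rewrite !nth_cut !ifT //; lia.
  + by rewrite nth_cut ifT; [apply: le_trans hL _; apply: ds; lia|lia].
  apply: h3 => //; first by apply: le_trans hL _; apply: ds; lia.
  apply: le_trans ht; apply: le_trans (shrink_third h (desc_cut _ _ ds) _) => //.
  by rewrite nth_cut ifT; [apply: ds; lia|lia].
Qed.

End RealLists.

(** * Potentials *)

Section Potential.
Variable R : realFieldType.
Implicit Types (s : seq R) (psi e : R -> R).

(* Gaining [C] per agent and [lam] per unit of value among the first [2 n] goods,
   and deferring the charge [e] of the goods behind them. *)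
Definition pot psi e (C lam : R) n s : R :=
  \sum_(y <- s) psi y - C * n%:R - lam * psum id s (2 * n)
  - (\sum_(y <- s) e y - psum e s (2 * n)).

Lemma psum2S psi s n :
  psum psi s (2 * n.+1) = psum psi s (2 * n) + psi s`_(2 * n) + psi s`_(2 * n).+1.
Proof.
rewrite /psum; have -> : (2 * n.+1 = (2 * n).+2)%N by lia.
by rewrite !big_ord_recr.
Qed.

Lemma psum_cut psi q l s n : (2 * n <= q)%N ->
  psum psi (cut q l s) (2 * n) = psum psi s (2 * n).
Proof. by move=> h; apply: eq_psum => p hp; rewrite nth_cut ifT //; lia. Qed.

(** The removed goods are the last two of the first [2 * n.+2] and the one behind them, so only the
    latter takes a deferred charge along. *)
Lemma pot_R2 psi e C lam n s : psi 0 = 0 -> e 0 = 0 ->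
  psi s`_(2 * n.+1) + psi s`_(2 * n.+1).+1 + psi s`_(2 * n.+1).+2
    - e s`_(2 * n.+1).+2 <= C + lam * (s`_(2 * n.+1) + s`_(2 * n.+1).+1) ->
  pot psi e C lam n.+2 s <= pot psi e C lam n.+1 (cut (2 * n.+1) 3 s).
Proof.
move=> psi0 e0; rewrite /pot !(psum2S _ _ n.+1) !psum_cut //.
rewrite (@sum_cut _ psi (2 * n.+1) 3 s) // (@sum_cut _ e (2 * n.+1) 3 s) //.
rewrite !big_ord_recr !big_ord0 /= !add0r !addn0 !addn1 !addn2 ?addn3.
rewrite -[n.+2%:R]natr1; lra.
Qed.

(** The goods at [2 * n.+1] and next to it leave the first [2 n] places, so their charge becomes
    due, while the removed goods take theirs along. For [n = 0] the two groups share a good, whose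
    charges cancel. *)
Lemma pot_R3 psi e C lam n s : psi 0 = 0 -> e 0 = 0 ->
  (psi s`_(3 * n.+1) - e s`_(3 * n.+1))
  + (psi s`_(3 * n.+1).+1 - e s`_(3 * n.+1).+1)
  + (psi s`_(3 * n.+1).+2 - e s`_(3 * n.+1).+2)
  + (psi s`_(3 * n.+1).+3 - e s`_(3 * n.+1).+3)
    + e s`_(2 * n.+1) + e s`_(2 * n.+1).+1
  <= C + lam * (s`_(2 * n.+1) + s`_(2 * n.+1).+1) ->
  pot psi e C lam n.+2 s <= pot psi e C lam n.+1 (cut (3 * n.+1) 4 s).
Proof.
move=> psi0 e0; rewrite /pot !(psum2S _ _ n.+1) !psum_cut //; try lia.
rewrite (@sum_cut _ psi (3 * n.+1) 4 s) // (@sum_cut _ e (3 * n.+1) 4 s) //.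
rewrite !big_ord_recr !big_ord0 /= !add0r !addn0 !addn1 !addn2 ?addn3.
rewrite -[n.+2%:R]natr1; lra.
Qed.

Definition base n s j : R := s`_j + s`_(2 * n - j.+1) + s`_(2 * n + j).

Definition bagsum psi n s (F : nat -> seq R) j : R :=
  psi s`_j + psi s`_(2 * n - j.+1) + psi s`_(2 * n + j) + \sum_(y <- F j) psi y.

(* The end of a failed run, seen by an agent who is still there: bag [j]
   (counted from 0) has received the fillers [F j], the agent did not want it
   before its last filler, and still does not want bag [kf]. *)
Definition stuck n s (F : nat -> seq R) kf :=
  [/\ (kf < n)%N,
      forall psi, psi 0 = 0 ->
        \sum_(y <- s) psi y = \sum_(j < n) bagsum psi n s F j,
      forall j, (j < n)%N -> F j = [::] \/
        exists F' g, F j = rcons F' g /\ base n s j + \sum_(y <- F') y < 180,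
      forall j y, y \in F j -> 0 <= y <= s`_(3 * n)
    & bagsum id n s F kf < 180].

(** Neither R_2 nor R_3 is applicable for this agent; positions are counted from 0. *)
Definition reduced n s :=
  s`_(2 * n.-1) + s`_(2 * n.-1).+1 + s`_(2 * n) < 180 /\
  s`_(3 * n.-1) + s`_(3 * n.-1).+1 + s`_(3 * n.-1).+2 + s`_(3 * n) < 180.

Lemma reduced_lt n s : desc s -> (0 < n)%N -> reduced n s ->
  s`_(2 * n) < 60 /\ s`_(3 * n) < 45.
Proof.
move=> ds n0 [h2 h3].
have a1 := ds (2 * n.-1)%N (2 * n)%N ltac:(lia).
have a2 := ds (2 * n.-1).+1 (2 * n)%N ltac:(lia).
have b1 := ds (3 * n.-1)%N (3 * n)%N ltac:(lia).
have b2 := ds (3 * n.-1).+1 (3 * n)%N ltac:(lia).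
have b3 := ds (3 * n.-1).+2 (3 * n)%N ltac:(lia).
split; lra.
Qed.

(** Before its last filler the bag was below 180, and a filler is worth at most the good at position
    [3 * n]. *)
Lemma stuck_bag n s F kf j : desc s -> stuck n s F kf -> (j < n)%N ->
  F j = [::] \/ base n s j < 180 /\ bagsum id n s F j < 180 + s`_(3 * n).
Proof.
move=> ds [_ _ h3 h4 _] jn; case: (h3 j jn) => [->|[F' [g [EF hF]]]]; [by left|right].
have hb y : y \in F' -> 0 <= y.
  by move=> yF; have := h4 j y; rewrite EF mem_rcons inE yF orbT => /(_ isT) /andP[].
have /andP[_ hg] : 0 <= g <= s`_(3 * n) by apply: (h4 j); rewrite EF mem_rcons inE eqxx.
have : 0 <= \sum_(y <- F') y by rewrite big_seq sumr_ge0.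
rewrite /bagsum EF -cats1 big_cat big_seq1 /= -/(base n s j) => h.
by split; lra.
Qed.

Lemma stuck_bag_kf n s F kf : desc s -> stuck n s F kf -> base n s kf < 180.
Proof.
move=> ds [_ _ _ h4]; apply: le_lt_trans.
rewrite /bagsum -/(base n s kf) lerDl big_seq sumr_ge0 // => y /h4.
by case/andP.
Qed.

(** An averaging argument: only bag 0, that is [C_1], may exceed [c], and the unfinished bag [kf]
    makes up for it. *)
Lemma sum_lt_one_bad n kf (G : nat -> R) (c eps : R) : (kf < n)%N -> 0 <= eps ->
  (forall j, (j < n)%N -> j != kf -> G j <= c + (if j == 0%N then eps else 0)) ->
  G kf < c - eps -> \sum_(j < n) G j < c * n%:R.
Proof.
move=> hk e0 hG hkf.
rewrite (bigD1 (Ordinal hk)) //=.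
have h1 : \sum_(j < n | j != Ordinal hk) G j <=
   \sum_(j < n | j != Ordinal hk) (c + (if j == 0%N :> nat then eps else 0)).
  by apply: ler_sum => j hj; apply: hG.
have h2 : \sum_(j < n | j != Ordinal hk) (c + (if j == 0%N :> nat then eps else 0))
    <= c * n%:R - c + eps.
  rewrite big_split /= sumr_const cardC1 card_ord.
  apply: lerD.
    by rewrite -[c *+ _]mulr_natr -subn1 natrB ?mulrBr ?mulr1 //; lia.
  case: n hk {hG h1} => // n hk.
  rewrite -big_mkcondr /= sumr_const.
  set A := #|_|; have : (A <= 1)%N.
    rewrite -(card1 (@ord0 n)); apply/subset_leq_card/subsetP => j.
    by rewrite !inE => /andP[_ hj].
  by case: A => [|[|]]; rewrite ?mulr0n ?mulr1n.
lra.
Qed.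

(** The positive part of [y - thr]. *)
Definition excess (thr y : R) : R := if thr <= y then y - thr else 0.

Lemma excess_ge0 thr y : 0 <= excess thr y.
Proof. by rewrite /excess; case: ifP => // h; rewrite subr_ge0. Qed.

Lemma excessP thr y : excess thr y = 0 /\ y <= thr \/ excess thr y = y - thr /\ thr <= y.
Proof. by rewrite /excess; case: (leP thr y) => h; [right|left; split => //; exact: ltW]. Qed.

Lemma excess0 thr : 0 < thr -> excess thr 0 = 0.
Proof. by rewrite /excess; case: ifP => //; lra. Qed.

Lemma excess_beyond thr s k : 0 < thr -> desc s -> s`_k <= thr ->
  \sum_(y <- s) excess thr y = psum (excess thr) s k.
Proof.
move=> h0 ds hk.
rewrite -{1}(cat_take_drop k s) big_cat /= sum_take ?excess0 //.
rewrite -[RHS]addr0; congr (_ + _).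
rewrite big_seq big1 // => y /(nthP 0)[p hp <-]; rewrite nth_drop.
have : s`_(k + p) <= thr by apply: le_trans hk; apply: ds; lia.
by case: (excessP thr s`_(k + p)) => -[-> h] //; lra.
Qed.

Lemma psum_fold psi s n :
  psum psi s (2 * n) = \sum_(j < n) (psi s`_j + psi s`_(2 * n - j.+1)).
Proof. exact: (sum_fold2 (fun p => psi s`_p)). Qed.

(* Goods that leave the first [2 n] places because of R_3 may exceed [tau];
   that excess is paid for by the bag of R_3 itself. *)
Lemma shrink_stuck_sum (tau : R) n s n' s' F kf :
  56 <= tau <= 60 -> desc s -> (0 < n)%N -> s`_0 + s`_1 < 180 -> s`_(2 * n) <= tau ->
  shrink n s n' s' -> reduced n' s' -> stuck n' s' F kf ->
  \sum_(y <- s) y <= (180 + tau) * n%:R.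
Proof.
move=> /andP[t1 t2] ds n0 h01 htau sh red st.
have n'0 := shrink_gt0 sh n0; have ds' := shrink_desc sh ds.
have ex0 : excess tau 0 = 0 by apply: excess0; lra.
(* No charge is outstanding at the start, since all goods above [tau] are among the first [2 n]. *)
have start : \sum_(y <- s) y - (180 + tau) * n%:R <= pot id (excess tau) (180 + tau) 0 n s.
  rewrite /pot (excess_beyond _ ds htau) ?subrr; lra.
suff fin : pot id (excess tau) (180 + tau) 0 n' s' <= 0.
  have mid : pot id (excess tau) (180 + tau) 0 n s <= pot id (excess tau) (180 + tau) 0 n' s'.
    apply: (shrink_potential (X := s'`_(2 * n').-1) (t := s'`_(3 * n').-1) (L := 0) sh) => //.
    - exact: desc_ge0.
    - move=> {}n {start h01 sh n0 htau} {}s {}ds h01 _ _; apply: pot_R2 => //=.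
      have b1 := ds 0%N (2 * n.+1)%N ltac:(clear; lia).
      have b2 := ds 1%N (2 * n.+1).+1 ltac:(clear; lia).
      have := excessP tau s`_(2 * n.+1).+2; lra.
    move=> {}n {start h01 sh n0 htau} {}s {}ds h01 _ _ _ hu; apply: pot_R3 => //=.
    have b2 := ds 1%N (2 * n.+1)%N ltac:(clear; lia).
    have b1 := ds 0%N 1%N ltac:(clear; lia).
    have c1 := ds (2 * n.+1)%N (2 * n.+1).+1 ltac:(clear; lia).
    have c2 := ds (2 * n.+1).+1 (2 * n.+1).+2 ltac:(clear; lia).
    have c0 := desc_ge0 (2 * n.+1).+2 ds.
    have trunc p : ((2 * n.+1).+2 <= p)%N ->
        s`_p - excess tau s`_p <= tau /\ s`_p - excess tau s`_p <= s`_(2 * n.+1).+2.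
      by move=> hp; have := ds _ _ hp; have := excessP tau s`_p; split; lra.
    have [d1 d1'] := trunc (3 * n.+1).+1 ltac:(clear; lia).
    have [d2 d2'] := trunc (3 * n.+1).+2 ltac:(clear; lia).
    have [d3 d3'] := trunc (3 * n.+1).+3 ltac:(clear; lia).
    have e1 := excessP tau s`_(2 * n.+1); have e2 := excessP tau s`_(2 * n.+1).+1.
    (* With two agents left, the first good of R_3 is the second good of R_2, and the truncation
       bound does not reach it. *)
    case: n c1 c2 c0 b2 hu d1 d1' d2 d2' d3 d3' e1 e2 trunc => [|n] c1 c2 c0 b2 hu
       d1 d1' d2 d2' d3 d3' e1 e2 trunc.
      have -> : (3 * 1 = (2 * 1).+1)%N by [].
      move: d1 d1' d2 d2' d3 d3' c1 c2 c0 b2 hu e1 e2 => /=.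
      move: (s`_ _) (s`_ _) (s`_ _) => A B C *; lra.
    have [d0 d0'] := trunc (3 * n.+2)%N ltac:(clear; lia).
    lra.
  lra.
rewrite /pot /= !psum_fold mul0r subr0; case: (st) => _ hsum _ _ _.
rewrite (hsum id) // (hsum (excess tau)) // -!sumrB.
rewrite mulr_natr -[X in _ *+ X]card_ord -sumr_const -!sumrB.
apply: sumr_le0 => j _.
have jn := ltn_ord j.
have [r60 r45] := reduced_lt ds' n'0 red.
have := stuck_bag ds' st jn.
have p01 : s'`_0 + s'`_1 < 180 by rewrite !(shrink_prefix sh) //; move: n'0; clear; lia.
have b1 := ds' 0%N j ltac:(move: jn; clear; lia).
have b2 := ds' 1%N (2 * n' - j.+1)%N ltac:(move: jn; clear; lia).
have hF : 0 <= \sum_(y <- F j) excess tau y by rewrite sumr_ge0 // => y _; exact: excess_ge0.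
have := excessP tau s'`_(2 * n' + j); have := excess_ge0 tau s'`_(2 * n' + j).
(* A bag without fillers is a pair below 180 and a truncated third good; a bag with fillers stays
   below 180 + 45. *)
move=> h1 h2 [EF|[h3 h4]]; last by rewrite /bagsum /= in h4 *; lra.
by rewrite /bagsum EF !big_nil /=; lra.
Qed.

End Potential.

(** * Agents of N^1_1 *)

Ltac natlia := repeat match goal with
  | H : is_true (Order.le _ _) |- _ => clear H
  | H : is_true (Order.lt _ _) |- _ => clear H
  | H : _ \/ _ |- _ => clear H
  end; lia.

Section NonPriority.
Variable R : realFieldType.
Implicit Types (s : seq R) (psi e : R -> R).

(* Three goods of value in [4, 90] or two of value above [90] count as a full
   bundle; the slope 1/25 is what {124, 90, 25} requires. *)
Definition phi_low (y : R) : R := if 90 < y then 3 else if 4 <= y then 2 else y / 25.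

(* Made for bundles {h, l, l}, {h, h} and {l, l, l, l} with [h] near 120 and [l]
   near 60; the loss of at most 5 per good below 115 and 14 per good above is
   exactly what {124, 115} allows. *)
Definition phi_high (y : R) : R :=
  if y < 55 then y else if y < 60 then 55 else if y < 115 then y - 5 else 110.

Lemma phi_lowP y :
  [\/ phi_low y = 3 /\ 90 < y, phi_low y = 2 /\ 4 <= y <= 90
    | phi_low y = y / 25 /\ y < 4].
Proof.
rewrite /phi_low; case: (ltP 90 y) => h1; first by constructor 1.
by case: (leP 4 y) => h2; [constructor 2|constructor 3].
Qed.

Lemma phi_highP y :
  [\/ phi_high y = y /\ y < 55, phi_high y = 55 /\ 55 <= y < 60,
      phi_high y = y - 5 /\ 60 <= y < 115 | phi_high y = 110 /\ 115 <= y].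
Proof.
rewrite /phi_high; case: (ltP y 55) => h1; first by constructor 1.
case: (ltP y 60) => h2; first by constructor 2.
by case: (ltP y 115) => h3; [constructor 3|constructor 4].
Qed.

(** Two large goods, or four medium ones, already reach the required weight, so larger counts need
    not be told apart. *)
Lemma natr_cases2 (a : nat) : a%:R = 0 :> R \/ a%:R = 1 :> R \/ 2 <= a%:R :> R.
Proof. by case: a => [|[|a]]; [left|right; left|right; right; rewrite ler_nat]. Qed.

Lemma natr_cases4 (c : nat) : c%:R = 0 :> R \/ c%:R = 1 :> R \/ c%:R = 2 :> R \/
  c%:R = 3 :> R \/ 4 <= c%:R :> R.
Proof.
case: c => [|[|[|[|c]]]]; by [left|right; left|right; right; left|
  right; right; right; left|right; right; right; right; rewrite ler_nat].
Qed.

Lemma phi_low_cover s : (forall y, y \in s -> 0 <= y <= 124) ->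
  239 <= \sum_(y <- s) y -> 6 <= \sum_(y <- s) phi_low y.
Proof.
move=> hs.
(* [a] and [c] count the goods of weight 3 and 2, and [q] is the total value of the small ones. *)
have [a [c [q [q0 h1 h2]]]] : exists a c : nat, exists q : R, [/\ 0 <= q,
    \sum_(y <- s) y <= 124 * a%:R + 90 * c%:R + q &
    \sum_(y <- s) phi_low y = 3 * a%:R + 2 * c%:R + q / 25].
  elim: s hs => [|y s IH] hs.
    by exists 0%N, 0%N, 0; rewrite !big_nil; split; lra.
  have [] := IH; first by move=> z hz; apply: hs; rewrite inE hz orbT.
  move=> a [c [q [q0 h1 h2]]].
  have /andP[y0 y1] := hs y (mem_head _ _).
  rewrite !big_cons h2; case: (phi_lowP y) => -[-> hy].
  - by exists a.+1, c, q; rewrite -[a.+1%:R]natr1; split=> //; lra.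
  - by exists a, c.+1, q; rewrite -[c.+1%:R]natr1; split=> //; lra.
  - by exists a, c, (q + y); split=> //; lra.
rewrite h2 => h3; move: h1 h3.
have a0 := ler0n R a; have c0 := ler0n R c.
have [->|[->|ha]] := natr_cases2 a; have [->|[->|[->|[->|hc]]]] := natr_cases4 c; lra.
Qed.

(** With [a] goods from 115 on and [c] between 55 and 115, the loss is at most [14 a + 5 c]. If this
    is at most 19, then 239 - 19 = 220 remains; otherwise the counted goods alone weigh 220. *)
Lemma phi_high_cover s : (forall y, y \in s -> 0 <= y <= 124) ->
  239 <= \sum_(y <- s) y -> 220 <= \sum_(y <- s) phi_high y.
Proof.
move=> hs.
have [a [c [h1 h2]]] : exists a c : nat,
    \sum_(y <- s) phi_high y >= 110 * a%:R + 55 * c%:R /\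
    \sum_(y <- s) phi_high y >= \sum_(y <- s) y - 14 * a%:R - 5 * c%:R.
  elim: s hs => [|y s IH] hs.
    by exists 0%N, 0%N; rewrite !big_nil; split; lra.
  have [] := IH; first by move=> z hz; apply: hs; rewrite inE hz orbT.
  move=> a [c [h1 h2]].
  have /andP[y0 y1] := hs y (mem_head _ _).
  rewrite !big_cons; case: (phi_highP y) => -[-> hy].
  - by exists a, c; split; lra.
  - by exists a, c.+1; rewrite -[c.+1%:R]natr1; split; lra.
  - by exists a, c.+1; rewrite -[c.+1%:R]natr1; split; lra.
  - by exists a.+1, c; rewrite -[a.+1%:R]natr1; split; lra.
move=> h3; move: h1 h2 h3; have a0 := ler0n R a; have c0 := ler0n R c.
have [->|[->|ha]] := natr_cases2 a; have [->|[->|[->|[->|hc]]]] := natr_cases4 c; lra.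
Qed.

Lemma phi_low_le3 y : phi_low y <= 3.
Proof. by case: (phi_lowP y) => -[-> h]; lra. Qed.

Lemma phi_low_le2 y : y <= 90 -> phi_low y <= 2.
Proof. by move=> h90; case: (phi_lowP y) => -[-> h]; lra. Qed.

Lemma phi_low_small y : y < 4 -> phi_low y = y / 25.
Proof. by move=> h4; case: (phi_lowP y) => -[-> h]; lra. Qed.

Lemma phi_low0 : phi_low 0 = 0.
Proof. by rewrite phi_low_small ?mul0r. Qed.

Lemma phi_high_le110 y : phi_high y <= 110.
Proof. by case: (phi_highP y) => -[-> h]; lra. Qed.

Lemma phi_high_le y : 0 <= y -> phi_high y <= y.
Proof. by move=> y0; case: (phi_highP y) => -[-> h]; lra. Qed.

Lemma phi_high_mono : {homo phi_high : x y / x <= y}.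
Proof.
by move=> x y hxy; case: (phi_highP x) => -[-> h]; case: (phi_highP y) => -[-> h']; lra.
Qed.

Lemma phi_high0 : phi_high 0 = 0.
Proof. by case: (phi_highP 0) => -[-> h]; lra. Qed.

(** The case without pair bonus and deferred charge: an average weight of at least [c] per agent
    survives phase 3. *)
Lemma shrink_sum_ge psi c n s n' s' : psi 0 = 0 ->
  c * n%:R <= \sum_(y <- s) psi y ->
  pot psi (fun=> 0) c 0 n s <= pot psi (fun=> 0) c 0 n' s' ->
  c * n'%:R <= \sum_(y <- s') psi y.
Proof.
by move=> psi0 h; rewrite /pot /psum !big1_eq; lra.
Qed.

(** * A failed run seen by an agent of N^1_1 *)

Section Run.
Variables (N : R) (n1 b n' : nat) (s1 s' : seq R) (F : nat -> seq R) (kf : nat).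
Let s := drop (2 * b) s1.
Let n := (n1 - b)%N.
Hypotheses (hN : 239 <= N) (ds1 : desc s1) (h124 : s1`_0 <= 124).
Hypotheses (h56 : 56 <= s1`_(2 * n1)) (h60 : s1`_(2 * n1) < 60) (bn : (b < n1)%N).
Hypotheses (hS : N * n1%:R <= \sum_(y <- s1) y) (hT : psum id s1 (2 * n1) <= 180 * n1%:R).
Hypotheses (hlow : 6 * n1%:R <= \sum_(y <- s1) phi_low y)
           (hhigh : 220 * n1%:R <= \sum_(y <- s1) phi_high y).
Hypotheses (h01 : s`_0 + s`_1 < 180) (sh : shrink n s n' s').
Hypotheses (red : reduced n' s') (st : stuck n' s' F kf).

Lemma nth_s p : s`_p = s1`_(2 * b + p).
Proof. by rewrite nth_drop. Qed.

Lemma desc_s : desc s.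
Proof. by move=> p q h; rewrite !nth_s; apply: ds1; natlia. Qed.

Lemma n_gt0 : (0 < n)%N.
Proof. by rewrite /n; natlia. Qed.

Lemma n'_gt0 : (0 < n')%N.
Proof. exact: shrink_gt0 sh n_gt0. Qed.

Lemma desc_s' : desc s'.
Proof. exact: shrink_desc sh desc_s. Qed.

(** Each bag of phase 2 takes one agent and the two best goods, which moves this good along with the
    index [2 n]. *)
Lemma s_2n : s`_(2 * n) = s1`_(2 * n1).
Proof. by rewrite nth_s; congr nth; rewrite /n; natlia. Qed.

Lemma n_nat : n%:R = n1%:R - b%:R :> R.
Proof. by rewrite /n natrB //; natlia. Qed.

Lemma sum_s psi : psi 0 = 0 ->
  \sum_(y <- s1) psi y = psum psi s1 (2 * b) + \sum_(y <- s) psi y.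
Proof. by move=> p0; rewrite -{1}(cat_take_drop (2 * b) s1) big_cat /= sum_take. Qed.

Lemma psum_s psi : psum psi s1 (2 * n1) = psum psi s1 (2 * b) + psum psi s (2 * n).
Proof.
rewrite /psum; have -> : (2 * n1 = 2 * b + 2 * n)%N by rewrite /n; natlia.
rewrite big_split_ord /=; congr (_ + _).
by apply: eq_bigr => p _; rewrite nth_s.
Qed.

Lemma psum_le_cst psi c k : (forall p, psi s1`_p <= c) -> psum psi s1 (2 * k) <= c * 2 * k%:R.
Proof.
move=> h; apply: le_trans (_ : \sum_(p < 2 * k) c <= _).
  by apply: ler_sum => p _; exact: h.
by rewrite sumr_const card_ord -[c *+ _]mulr_natr natrM mulrA.
Qed.

Lemma s'01 : s'`_0 + s'`_1 < 180.
Proof. by have n0 := n'_gt0; rewrite !(shrink_prefix sh) //; natlia. Qed.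

Lemma s'_le90 j : (0 < j)%N -> s'`_j <= 90.
Proof.
move=> j0; have := s'01; have := desc_s' (leq0n 1); have := desc_s' j0; lra.
Qed.

Lemma s'_ge56 j : (j < 2 * n')%N -> 56 <= s'`_j.
Proof.
move=> hj; rewrite (shrink_prefix sh) //; have := shrink_le sh => le.
by move: h56; rewrite -s_2n => /le_trans; apply; apply: desc_s; natlia.
Qed.

Lemma s_ge56 : 56 <= s`_(2 * n).-1.
Proof.
by move: h56; rewrite -s_2n => /le_trans; apply; apply: desc_s; natlia.
Qed.

(** * The first bag whose initial goods are worth less than 180 *)

Section FirstLow.
Variable k : nat.
Let X := s'`_(2 * n' - k.+1).
Let t := s'`_(2 * n' + k).
Hypotheses (kn' : (k < n')%N) (hk : base n' s' k < 180).
Hypothesis (hmin : forall j, (j < k)%N -> 180 <= base n' s' j).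

Lemma low_facts : [/\ 0 <= t, t <= X, X <= s'`_k & s'`_k + X + t < 180].
Proof.
split; [exact: desc_ge0 desc_s'| | |exact: hk]; apply: desc_s'; natlia.
Qed.

Lemma bottom_leX : s'`_(2 * n').-1 <= X.
Proof. by apply: desc_s'; natlia. Qed.

Lemma third_let : s'`_(3 * n').-1 <= t.
Proof. by apply: desc_s'; natlia. Qed.

Lemma filler_let j y : y \in F j -> 0 <= y <= t.
Proof.
case: st => _ _ _ h _ /h /andP[-> h'] /=; apply: le_trans h' _; apply: desc_s'; natlia.
Qed.

Lemma k_le_kf : (k <= kf)%N.
Proof.
rewrite leqNgt; apply/negP => /hmin.
have := stuck_bag_kf desc_s' st; lra.
Qed.

Lemma unfilled_below j : (j < k)%N -> F j = [::].
Proof.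
move=> jk; have [//|[h _]] := stuck_bag desc_s' st (ltn_trans jk kn').
by exfalso; have := hmin jk; lra.
Qed.

Lemma second_leX j : (j <= k)%N -> s'`_(2 * n' - j.+1) <= X.
Proof. by move=> h; apply: desc_s'; natlia. Qed.

Lemma third_lt60 j : s'`_(2 * n' + j) < 60.
Proof.
have [h _] := reduced_lt desc_s' n'_gt0 red; apply: le_lt_trans h; apply: desc_s'; natlia.
Qed.

(** The first two goods of the bags from [k] on stand at positions between [k] and
    [2 * n' - k.+1]. *)
Lemma above_facts j : (k <= j)%N -> (j < n')%N ->
  [/\ X <= s'`_j, s'`_j <= s'`_k, X <= s'`_(2 * n' - j.+1),
      s'`_(2 * n' - j.+1) <= s'`_k & s'`_(2 * n' + j) <= t].
Proof. by move=> h1 h2; split; apply: desc_s'; natlia. Qed.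

(* Every bag has [phi_high]-weight at most 220, except [C_1] (by 2). *)
Lemma no_high : t < 57 + 1/2.
Proof.
rewrite ltNge; apply/negP => ht.
have [t0 tX Xk hk'] := low_facts.
(* A pair given in phase 2 weighs at most 2 * 110. *)
have start : 220 * n%:R <= \sum_(y <- s) phi_high y.
  move: hhigh; rewrite (sum_s phi_high0) n_nat.
  have := psum_le_cst b (fun p => phi_high_le110 s1`_p); lra.
have : 220 * n'%:R <= \sum_(y <- s') phi_high y.
  apply: (shrink_sum_ge phi_high0 start).
  apply: (shrink_potential (X := X) (t := t) sh desc_s n_gt0 h01 s_ge56 bottom_leX third_let).
  - move=> m z dz _ hX _; apply: pot_R2 => //=; first exact: phi_high0.
    have c1 := dz _ _ (leqnSn (2 * m.+1)); have c2 := dz _ _ (leqnSn (2 * m.+1).+1).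
    have h2 := phi_high_mono c1; have h3 := phi_high_mono c2.
    have : phi_high z`_(2 * m.+1) <= 60.
      by case: (phi_highP z`_(2 * m.+1)) => -[-> h]; lra.
    lra.
  - move=> m z dz _ _ _ ht3 _; apply: pot_R3 => //=; first exact: phi_high0.
    have H p : (3 * m.+1 <= p)%N -> phi_high z`_p <= 55.
      move=> hp; have := dz _ _ hp => hz.
      by case: (phi_highP z`_p) => -[-> h]; lra.
    have := H (3 * m.+1)%N ltac:(natlia); have := H (3 * m.+1).+1 ltac:(natlia).
    have := H (3 * m.+1).+2 ltac:(natlia); have := H (3 * m.+1).+3 ltac:(natlia); lra.
apply/negP; rewrite -ltNge; case: (st) => kfn hsum _ hfil hkf.
rewrite (hsum _ phi_high0).
have sumF psi j : (forall y, 0 <= y -> psi y <= y) ->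
    \sum_(y <- F j) psi y <= \sum_(y <- F j) y.
  move=> h; rewrite big_seq [leRHS]big_seq; apply: ler_sum => y /filler_let /andP[y0 _].
  exact: h.
have s'0 p : 0 <= s'`_p by exact: desc_ge0 desc_s'.
have [r60 r45] := reduced_lt desc_s' n'_gt0 red.
apply: (@sum_lt_one_bad _ _ kf _ _ 2) => // [j jn jkf|]; last first.
  apply: (@le_lt_trans _ _ 180); last by lra.
  apply: le_trans (ltW hkf); rewrite /bagsum /=.
  have := sumF phi_high kf phi_high_le.
  have := phi_high_le (s'0 kf); have := phi_high_le (s'0 (2 * n' - kf.+1)%N).
  have := phi_high_le (s'0 (2 * n' + kf)%N); lra.
(* From [2 X + t < 180] and [t >= 57 + 1/2]. *)
have hX61 : X <= 61 + 1/4 by lra.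
have third55 : phi_high s'`_(2 * n' + j) <= 55.
  by have := third_lt60 j; case: (phi_highP s'`_(2 * n' + j)) => -[-> h]; lra.
have small z : z <= 61 + 1/4 -> phi_high z <= 56 + 1/4.
  by move=> hz; case: (phi_highP z) => -[-> h]; lra.
case: (ltnP j k) => jk.
  rewrite /bagsum unfilled_below // big_nil addr0.
  have h2 := small _ (le_trans (second_leX (ltnW jk)) hX61).
  case: (posnP j) => [j0|jp]; first by subst j; have := phi_high_le110 s'`_0; lra.
  have : phi_high s'`_j <= 85.
    by have := s'_le90 jp; case: (phi_highP s'`_j) => -[-> h]; lra.
  lra.
have [a1 a2 a3 a4 a5] := above_facts jk jn.
(* From bag [k] on, the first two goods lie between 57.5 and 65, where the weight falls short of the
   value by at least 2.5; two such losses bring 225 down to 220. *)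
have loss z : X <= z -> z <= s'`_k -> phi_high z <= z - (2 + 1/2).
  by move=> *; case: (phi_highP z) => -[-> h]; lra.
have l1 := loss _ a1 a2; have l2 := loss _ a3 a4.
suff: bagsum phi_high n' s' F j <= 220 by case: ifP => _; lra.
case: (stuck_bag desc_s' st jn) => [EF|[_ hb]].
  by rewrite /bagsum EF big_nil; lra.
have := sumF phi_high j phi_high_le.
have := phi_high_le (s'0 (2 * n' + j)%N).
by rewrite /bagsum /= in hb *; lra.
Qed.

(* Every bag has [phi_low]-weight at most 6, except [C_1] (by 1). *)
Lemma no_low : X < 88.
Proof.
rewrite ltNge; apply/negP => hX.
(* The first two goods of bag [k] are at least 88 each, so [t < 4]. *)
have [t0 tX Xk hk'] := low_facts.
have start : 6 * n%:R <= \sum_(y <- s) phi_low y.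
  move: hlow; rewrite (sum_s phi_low0) n_nat.
  have := psum_le_cst b (fun p => phi_low_le3 s1`_p); lra.
have : 6 * n'%:R <= \sum_(y <- s') phi_low y.
  apply: (shrink_sum_ge phi_low0 start).
  apply: (shrink_potential (X := X) (t := t) sh desc_s n_gt0 h01 s_ge56 bottom_leX third_let).
  - move=> m z dz z01 _ _; apply: pot_R2 => //=; first exact: phi_low0.
    have H p : (0 < p)%N -> phi_low z`_p <= 2.
      move=> hp; apply: phi_low_le2; have := dz _ _ hp; have := dz _ _ (leq0n 1); lra.
    have := H (2 * m.+1)%N ltac:(natlia); have := H (2 * m.+1).+1 ltac:(natlia).
    have := H (2 * m.+1).+2 ltac:(natlia); lra.
  - move=> m z dz _ _ _ ht3 _; apply: pot_R3 => //=; first exact: phi_low0.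
    have H p : (3 * m.+1 <= p)%N -> phi_low z`_p <= 1.
      move=> hp; have := dz _ _ hp => hz; rewrite phi_low_small; lra.
    have := H (3 * m.+1)%N ltac:(natlia); have := H (3 * m.+1).+1 ltac:(natlia).
    have := H (3 * m.+1).+2 ltac:(natlia); have := H (3 * m.+1).+3 ltac:(natlia); lra.
apply/negP; rewrite -ltNge; case: (st) => kfn hsum _ hfil hkf.
rewrite (hsum _ phi_low0).
have sumF j : \sum_(y <- F j) phi_low y = (\sum_(y <- F j) y) / 25.
  rewrite mulr_suml big_seq [RHS]big_seq; apply: eq_bigr => y /filler_let /andP[_ yt].
  by rewrite phi_low_small //; lra.
have fil3 : s'`_(3 * n') <= t by apply: desc_s'; natlia.
have third j : (k <= j)%N -> phi_low s'`_(2 * n' + j) = s'`_(2 * n' + j) / 25.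
  move=> jk; rewrite phi_low_small //; apply: le_lt_trans (_ : t < 4); last lra.
  by apply: desc_s'; natlia.
(* Besides the first two goods, each at least 88, less than 184 - 176 = 8 of value is left, and it
   is weighed with slope 1/25. *)
have above j : (k <= j)%N -> (j < n')%N -> bagsum id n' s' F j < 184 ->
    bagsum phi_low n' s' F j <= phi_low s'`_j + phi_low s'`_(2 * n' - j.+1) + 8 / 25.
  move=> jk jn; have [a1 a2 a3 a4 a5] := above_facts jk jn.
  by rewrite /bagsum /= sumF third //; lra.
have second j : (j < n')%N -> phi_low s'`_(2 * n' - j.+1) <= 2.
  by move=> jn; apply/phi_low_le2/s'_le90; natlia.
have bagkf := above kf k_le_kf kfn ltac:(lra).
have kf2 := second kf kfn.
(* If [k = 0], then [C_1] has no defect, but [kf] may be 0; otherwise [kf > 0], and the unfinished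
   bag is light enough to pay for a defect of 1. *)
case: (posnP k) => [k0|kp].
  apply: (@sum_lt_one_bad _ _ kf _ _ 0) => // [j jn jkf|]; last first.
    by have := phi_low_le3 s'`_kf; lra.
  rewrite if_same addr0.
  have hb : bagsum id n' s' F j < 184.
    case: (stuck_bag desc_s' st jn) => [EF|[_ hb]]; last lra.
    have [a1 a2 a3 a4 a5] := @above_facts j ltac:(natlia) jn.
    have c1 := desc_s' (leq0n j); have c2 := @desc_s' 1%N (2 * n' - j.+1)%N ltac:(natlia).
    by have := s'01; rewrite /bagsum EF big_nil /=; lra.
  have := above j ltac:(natlia) jn hb; have := second j jn.
  by have := phi_low_le3 s'`_j; lra.
have kfp : (0 < kf)%N by apply: leq_trans k_le_kf.
apply: (@sum_lt_one_bad _ _ kf _ _ 1) => // [j jn jkf|]; last first.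
  by have := phi_low_le2 (s'_le90 kfp); lra.
case: (ltnP j k) => jk.
  rewrite /bagsum unfilled_below // big_nil addr0.
  have h3 : phi_low s'`_(2 * n' + j) <= 2 by apply/phi_low_le2/s'_le90; natlia.
  have h2 := second j jn; case: eqP => j0; first by have := phi_low_le3 s'`_j; lra.
  have : phi_low s'`_j <= 2 by apply/phi_low_le2/s'_le90; natlia.
  lra.
have jp : (0 < j)%N by apply: leq_trans jk.
have hb : bagsum id n' s' F j < 184.
  case: (stuck_bag desc_s' st jn) => [EF|[_ hb]]; last lra.
  have [a1 a2 a3 a4 a5] := above_facts jk jn.
  have c1 := desc_s' (leq0n j); have c2 := @desc_s' 1%N (2 * n' - j.+1)%N ltac:(natlia).
  by have := s'01; rewrite /bagsum EF big_nil /=; lra.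
have := above j jk jn hb; have := second j jn; have := phi_low_le2 (s'_le90 jp).
by case: ifP => _; lra.
Qed.

(** Each bag is compared with [C] plus [lam] times the value of its pair; [X < 88] makes this work
    for R_2, and [t < 57 + 1/2] for R_3. *)
Lemma no_middle : False.
Proof.
have [t0 tX Xk hk'] := low_facts.
have ht := no_high; have hX := no_low.
(* This slope gives 239 + 68 lam = 248, which pays for two goods of 124 in phase 2. As a pair is
   worth at least 112, R_3 can spend 239 - 68 lam = 230 = 4 * (57 + 1/2). *)
pose lam : R := 9 / 68; pose C := N - 180 * lam.
(* In R_2, two goods below 88 and a third one counted up to 62 give at most 238, within the
   available 239 - 4 lam. *)
pose e := excess (62 : R).
have e0 : e 0 = 0 by apply: excess0; lra.
have start : 0 <= pot id e C lam n s.
  have eb : \sum_(y <- s) e y = psum e s (2 * n).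
    by apply: excess_beyond; [lra|exact: desc_s|rewrite s_2n; move: h60; lra].
  rewrite /pot eb subrr subr0 n_nat.
  move: hS hT; rewrite (@sum_s id) // (psum_s id) /=.
  have h248 : psum id s1 (2 * b) <= 124 * 2 * b%:R.
    by apply: psum_le_cst => p /=; apply: le_trans h124; exact: ds1.
  have bb : 239 * b%:R <= N * b%:R by rewrite ler_wpM2r.
  rewrite /C /lam !mulrBr !mulrBl; lra.
have mid : pot id e C lam n s <= pot id e C lam n' s'.
  apply: (shrink_potential (X := X) (t := t) sh desc_s n_gt0 h01 s_ge56 bottom_leX third_let).
  - move=> m z dz _ hzX _; apply: pot_R2 => //=.
    have c1 := dz _ _ (leqnSn (2 * m.+1)).
    have := excessP 62 z`_(2 * m.+1).+2; rewrite -/e /C /lam; move: hN; lra.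
  - move=> m z dz _ hzX hz56 hzt _; apply: pot_R3 => //=.
    have c1 := dz _ _ (leqnSn (2 * m.+1)).
    have c2 := dz (2 * m.+1).+1 (3 * m.+1)%N ltac:(natlia).
    have H p : (3 * m.+1 <= p)%N -> z`_p - e z`_p <= z`_(3 * m.+1).
      by move=> hp; have := dz _ _ hp; have := excess_ge0 62 z`_p; rewrite -/e; lra.
    have d0 := H (3 * m.+1)%N ltac:(natlia); have d1 := H (3 * m.+1).+1 ltac:(natlia).
    have d2 := H (3 * m.+1).+2 ltac:(natlia); have d3 := H (3 * m.+1).+3 ltac:(natlia).
    have e1 := excessP 62 z`_(2 * m.+1); have e2 := excessP 62 z`_(2 * m.+1).+1.
    rewrite -/e in e1 e2; rewrite /C /lam; move: hN; lra.
have fin : pot id e C lam n' s' < 0.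
  rewrite /pot psum_fold; case: (st) => kfn hsum _ hfil hkf.
  have ee : 0 <= \sum_(y <- s') e y - psum e s' (2 * n').
    rewrite (hsum _ e0) psum_fold -sumrB sumr_ge0 // => j _; rewrite /bagsum.
    have := excess_ge0 62 s'`_(2 * n' + j).
    have : 0 <= \sum_(y <- F j) e y by rewrite sumr_ge0 // => y _; exact: excess_ge0.
    rewrite /e; lra.
  rewrite (hsum id) //.
  suff: \sum_(j < n') (bagsum id n' s' F j - lam * (s'`_j + s'`_(2 * n' - j.+1)))
      < C * n'%:R.
    by rewrite sumrB -mulr_sumr /=; lra.
  have [r60 r45] := reduced_lt desc_s' n'_gt0 red.
  have Y56 j : (j < n')%N -> 56 <= s'`_j /\ 56 <= s'`_(2 * n' - j.+1).
    by move=> jn; split; apply: s'_ge56; natlia.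
  apply: (sum_lt_one_bad (G := fun j => bagsum id n' s' F j -
      lam * (s'`_j + s'`_(2 * n' - j.+1))) (eps := 2) kfn) => // [j jn jkf|]; last first.
    by have [] := Y56 _ kfn; rewrite /C /lam; move: hN; lra.
  have [y1 y2] := Y56 j jn; have h3 := third_lt60 j.
  have c1 := desc_s' (leq0n j); have c2 := @desc_s' 1%N (2 * n' - j.+1)%N ltac:(natlia).
  have h01' := s'01.
  (* Before [k] there are no fillers: the pair of [C_1] is only known to be below 180, which is what
     the allowance of 2 is for, and later pairs are below 90 + 88. *)
  case: (ltnP j k) => jk.
    rewrite /bagsum unfilled_below // big_nil addr0 /=.
    have h2 := second_leX (ltnW jk).
    case: eqP => [_|/eqP]; first by rewrite /C /lam; move: hN; lra.
    by rewrite -lt0n => /s'_le90; rewrite /C /lam; move: hN; lra.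
  have [a1 a2 a3 a4 a5] := above_facts jk jn.
  suff: bagsum id n' s' F j <= 225 by rewrite /C /lam; move: hN; case: ifP => _; lra.
  case: (stuck_bag desc_s' st jn) => [EF|[_ hb]]; last lra.
  (* If [t <= 45], the pair is below 180; otherwise both of its goods are below [180 - 2 t], and
     [360 - 3 t < 225]. *)
  by rewrite /bagsum EF big_nil /=; case: (leP t 45) => h45; lra.
lra.
Qed.

End FirstLow.

Lemma nonpriority_not_stuck : False.
Proof.
have ex : exists k, (k < n')%N && (base n' s' k < 180).
  exists kf; have [-> _ _ _ _] := st; exact: stuck_bag_kf desc_s' st.
case: (ex_minnP ex) => k /andP[kn hk] kmin.
apply: (no_middle kn hk) => j jk; rewrite leNgt; apply/negP => hj.
by have := kmin j; rewrite hj (ltn_trans jk kn) => /(_ isT); natlia.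
Qed.

End Run.
End NonPriority.

(** * Allocations and bags of goods *)

Lemma baggoods_iota (G : seq nat) q l : (0 < q)%N ->
  baggoods G (iota q l) = take l (drop q.-1 G).
Proof.
case: q => // q _ /=; elim: l q => [|l IH] q; first by rewrite take0.
rewrite /baggoods /= /Defs.inr /=; case: (ltnP q (size G)) => hq /=.
  by rewrite (drop_nth 0%N hq) /=; congr (_ :: _); exact: IH.
have := IH q.+1; rewrite /baggoods /Defs.inr => ->.
by rewrite !drop_oversize //; apply: leq_trans hq _.
Qed.

Lemma filter_cut (G : seq nat) q l : uniq G ->
  [seq g <- G | g \notin take l (drop q G)] = cut q l G.
Proof.
move=> uG; rewrite /cut addnC -drop_drop.
have E : G = take q G ++ take l (drop q G) ++ drop l (drop q G) by rewrite !cat_take_drop.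
move: uG E; move: (take q G) (take l _) (drop l _) => A B C uG E.
move: uG; rewrite E cat_uniq => /and3P[uA hA]; rewrite cat_uniq => /and3P[uB hB uC].
rewrite !filter_cat.
have -> : [seq g <- A | g \notin B] = A.
  apply/all_filterP/allP => g gA; apply/negP => gB.
  by move/hasP: hA => []; exists g; rewrite ?mem_cat ?gB.
have -> : [seq g <- B | g \notin B] = [::].
  by rewrite -(filter_pred0 B); apply: eq_in_filter => g /= ->.
suff -> : [seq g <- C | g \notin B] = C by [].
apply/all_filterP/allP => g gC; apply/negP => gB.
by move/hasP: hB => []; exists g.
Qed.

Lemma mem_baggoods (G ps : seq nat) g : g \in baggoods G ps ->
  exists2 p, p \in ps & [/\ (0 < p)%N, (p <= size G)%N & g = nth 0%N G p.-1].
Proof.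
case/mapP=> p; rewrite mem_filter => /andP[/andP[p0 pG] pps] ->.
by exists p.
Qed.

Lemma baggoods_sub (G ps : seq nat) : {subset baggoods G ps <= G}.
Proof.
by move=> g /mem_baggoods[p _ [p0 pG ->]]; apply: mem_nth; case: p p0 pG.
Qed.

Lemma uniq_baggoods (G ps : seq nat) : uniq G -> uniq ps -> uniq (baggoods G ps).
Proof.
move=> uG ups; rewrite map_inj_in_uniq ?filter_uniq // => p q.
rewrite !mem_filter => /andP[/andP[p0 pG] _] /andP[/andP[q0 qG] _] /eqP.
case: p q p0 pG q0 qG => [//|p] [//|q] _ pG _ qG.
by rewrite /posg nth_uniq //= => /eqP ->.
Qed.

Section Sums.
Variable R : realFieldType.

Lemma sum_baggoods (w : nat -> R) G ps : all (fun p => 0 < p)%N ps ->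
  \sum_(g <- baggoods G ps) w g = \sum_(p <- ps) (map w G)`_p.-1.
Proof.
rewrite /baggoods; elim: ps => [|p ps IH] /=; first by rewrite !big_nil.
case/andP=> p0 /IH {}IH; rewrite big_cons /Defs.inr p0 /=; case: leqP => hp.
  by rewrite big_cons IH (nth_map 0%N) //; case: p p0 hp.
by rewrite IH [X in _ = X + _]nth_default ?add0r // size_map; case: p p0 hp.
Qed.

Lemma sum_filter_mem (w : nat -> R) (G S : seq nat) : uniq G -> uniq S ->
  {subset S <= G} ->
  \sum_(g <- G) w g = \sum_(g <- S) w g + \sum_(g <- [seq g <- G | g \notin S]) w g.
Proof.
move=> uG uS sub; rewrite (bigID (fun g => g \in S)) /= big_filter; congr (_ + _).
rewrite -big_filter; apply: perm_big; apply: uniq_perm => //; first exact: filter_uniq.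
by move=> g; rewrite mem_filter; case: (boolP (g \in S)) => //= /sub ->.
Qed.
End Sums.

Section Allocation.
Variables (R : realFieldType) (v : nat -> nat -> R) (n m : nat) (alpha : R).

Definition settled (st : state) j :=
  [/\ alpha <= vS v j (st_alloc st j), uniq (st_alloc st j),
      {subset st_alloc st j <= goodsM m}
    & forall g, g \in st_alloc st j -> g \notin st_goods st].

(** Invariant of all four phases; it makes the allocation correct as soon as no agent is left. *)
Definition valid (st : state) :=
  [/\ uniq (st_agents st), {subset st_agents st <= agentsN n},
      subseq (st_goods st) (goodsM m),
      forall j, j \in agentsN n -> j \notin st_agents st -> settled st j
    & forall j j', j \in agentsN n -> j' \in agentsN n -> j \notin st_agents st ->
        j' \notin st_agents st -> j != j' ->
        forall g, g \in st_alloc st j -> g \notin st_alloc st j'].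

Lemma valid_uniq st : valid st -> uniq (st_goods st).
Proof. by case=> _ _ h _ _; exact: subseq_uniq h (iota_uniq _ _). Qed.

Lemma valid_give st i S : valid st -> i \in st_agents st -> uniq S ->
  {subset S <= st_goods st} -> alpha <= vS v i S -> valid (give st i S).
Proof.
move=> [uA sA sG hset hdis] iA uS subS hS.
have nin j : j \in agentsN n -> j \notin rem i (st_agents st) ->
    j = i \/ j != i /\ j \notin st_agents st.
  move=> jN; rewrite mem_rem_uniq // inE negb_and negbK.
  by case: eqVneq => [->|ji] /=; [left|right].
split=> /=.
- exact: rem_uniq.
- by move=> j /mem_rem /sA.
- exact: subseq_trans (filter_subseq _ _) sG.
- move=> j jN /(nin _ jN) [->|[ji jA]]; rewrite /settled /= ?eqxx ?(negPf ji).
    split=> // [g /subS /(mem_subseq sG) //|g gS].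
    by rewrite mem_filter gS.
  have [h1 h2 h3 h4] := hset j jN jA; split=> // g /h4.
  by rewrite mem_filter => /negPf ->; rewrite andbF.
- move=> j j' jN j'N /(nin _ jN) [->|[ji jA]] /(nin _ j'N) [->|[j'i j'A]];
    rewrite ?eqxx ?(negPf ji) ?(negPf j'i) //.
  + move=> _ g /subS gG; apply/negP => gj'.
    by have [_ _ _ /(_ _ gj')] := hset j' j'N j'A; rewrite gG.
  + move=> _ g gj; apply/negP => /subS gG.
    by have [_ _ _ /(_ _ gj)] := hset j jN jA; rewrite gG.
  + exact: hdis.
Qed.

Lemma valid_done st : valid st -> st_agents st = [::] ->
  is_allocation n m (st_alloc st) /\
  forall i, i \in agentsN n -> alpha <= vS v i (st_alloc st i).
Proof.
move=> [_ _ _ hset hdis] E; rewrite E in hset hdis; split; last first.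
  by move=> i iN; case: (hset i iN isT).
split=> [i iN|i i' iN i'N]; first by case: (hset i iN isT).
exact: hdis.
Qed.

Lemma size_give st i S : i \in st_agents st ->
  size (st_agents st) = (size (st_agents (give st i S))).+1.
Proof. by move=> iA /=; rewrite size_rem // prednK //; case: (st_agents st) iA. Qed.

Lemma count_give (a : pred nat) st i S : i \in st_agents st ->
  count a (st_agents st) = (a i + count a (st_agents (give st i S)))%N.
Proof.
by move=> iA /=; have /permP -> := perm_to_rem iA.
Qed.

End Allocation.

(** * Phases 2 and 3 *)

Section Phases.
Variables (R : realFieldType) (v : nat -> nat -> R) (n m : nat) (u : R) (Np : seq nat).
Hypothesis u_gt0 : 0 < u.
Hypotheses (v_ge0 : nonneg_vals v n m) (v_ord : ordered v n m).

(** Values in the unit [u], in which the threshold is 180. *)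
Definition view i (G : seq nat) : seq R := [seq v i g / u | g <- G].

Definition prios (A : seq nat) := count (fun j => j \notin Np) A.

Lemma vS_view i S : vS v i S = u * \sum_(g <- S) (v i g / u).
Proof.
by rewrite -mulr_suml mulrCA divff ?mulr1 // lt0r_neq0.
Qed.

Lemma bagval_view i G ps : all (fun p => 0 < p)%N ps ->
  bagval v i G ps = u * \sum_(p <- ps) (view i G)`_p.-1.
Proof. by move=> h; rewrite /bagval vS_view (sum_baggoods (fun g => v i g / u)). Qed.

Lemma bagval_lt i G ps : all (fun p => 0 < p)%N ps ->
  (bagval v i G ps < 180 * u) = (\sum_(p <- ps) (view i G)`_p.-1 < 180).
Proof. by move=> h; rewrite bagval_view // [180 * u]mulrC ltr_pM2l. Qed.

Lemma desc_view i G : i \in agentsN n -> subseq G (goodsM m) -> desc (view i G).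
Proof.
move=> iN sG p q pq.
have inG k : (k < size G)%N -> nth 0%N G k \in goodsM m.
  by move=> hk; apply: (mem_subseq sG); exact: mem_nth.
have ge0 k : 0 <= (view i G)`_k.
  case: (ltnP k (size G)) => hk; last by rewrite nth_default ?size_map.
  by rewrite (nth_map 0%N) // divr_ge0 ?(ltW u_gt0) // v_ge0 // inG.
case: (ltnP q (size G)) => hq; last first.
  by rewrite [leLHS]nth_default ?size_map ?ge0.
have hp : (p < size G)%N by apply: leq_ltn_trans hq.
rewrite !(nth_map 0%N) // ler_pM2r ?invr_gt0 // v_ord //.
- by have := inG p hp; rewrite mem_iota => /andP[].
- have srt : sorted leq G by apply: subseq_sorted sG (iota_sorted _ _); exact: leq_trans.
  by apply: (sorted_leq_nth leq_trans leqnn 0%N srt).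
- by have := inG q hq; rewrite mem_iota add1n ltnS => /andP[].
Qed.

Lemma view_cut i q l G : view i (cut q l G) = cut q l (view i G).
Proof. by rewrite /view /cut map_cat map_take map_drop. Qed.

Lemma view_drop i k G : view i (drop k G) = drop k (view i G).
Proof. by rewrite /view map_drop. Qed.

Lemma goods_give_iota (st : state) i q l : uniq (st_goods st) -> (0 < q)%N ->
  st_goods (give st i (baggoods (st_goods st) (iota q l))) = cut q.-1 l (st_goods st).
Proof. by move=> uG q0 /=; rewrite baggoods_iota // filter_cut. Qed.

Lemma valid_give_iota st i q l : valid v n m (180 * u) st -> i \in st_agents st ->
  180 * u <= bagval v i (st_goods st) (iota q l) ->
  valid v n m (180 * u) (give st i (baggoods (st_goods st) (iota q l))).
Proof.
move=> vst iA hb; apply: valid_give => //.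
  by apply: uniq_baggoods; [exact: valid_uniq vst|exact: iota_uniq].
exact: baggoods_sub.
Qed.

Lemma drop_goods (st : state) i : uniq (st_goods st) ->
  st_goods (give st i (baggoods (st_goods st) [:: 1; 2]%N)) = drop 2 (st_goods st).
Proof. by move=> uG; rewrite (@goods_give_iota st i 1 2) // /cut take0. Qed.

Lemma phase2_spec st st' : phase2 v (180 * u) Np st st' -> valid v n m (180 * u) st ->
  [/\ valid v n m (180 * u) st', {subset st_agents st' <= st_agents st},
      forall i, i \in st_agents st' ->
        (view i (st_goods st'))`_0 + (view i (st_goods st'))`_1 < 180
    & exists b, st_goods st' = drop (2 * b) (st_goods st) /\
                size (st_agents st) = (size (st_agents st') + b)%N].
Proof.
elim=> {st st'} [st i st' iA hb _ _ IH vst|st hstop vst]; last first.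
  split=> // [i /hstop|]; last by exists 0%N; rewrite drop0 addn0.
  by rewrite bagval_lt // !big_cons big_nil addr0.
have [v' sub stop [b [Eg Es]]] := IH (@valid_give_iota st i 1 2 vst iA hb).
split=> //; first by move=> j /sub /mem_rem.
exists b.+1; rewrite Eg drop_goods ?drop_drop; last exact: valid_uniq vst.
split; first by congr drop; lia.
by rewrite (size_give (baggoods (st_goods st) [:: 1; 2]%N) iA) Es addnS.
Qed.

Lemma count_big_le1 (s : seq R) : desc s -> s`_1 <= 90 -> (count (fun y => 90 < y)%R s <= 1)%N.
Proof.
move=> ds h1; case: s ds h1 => // y s ds h1 /=.
have -> : count (fun y => 90 < y) s = 0%N.
  apply/eqP; rewrite eqn0Ngt -has_count; apply/negP => /hasP[z /(nthP 0)[p hp <-]].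
  by have := ds 1%N p.+1 isT; rewrite /= in h1 *; lra.
by case: (90 < y).
Qed.

(** By priority, a bag taken by an agent of [Np] is worth less than 180 to [i]; any other bag is
    worth at most 360 and uses up a priority agent. *)
Lemma phase2_prio st st' i : phase2 v (180 * u) Np st st' -> valid v n m (180 * u) st ->
  i \in st_agents st' -> i \notin Np ->
  (forall g, g \in goodsM m -> v i g / u <= 180) ->
  [/\ \sum_(y <- view i (st_goods st)) y <= \sum_(y <- view i (st_goods st')) y
         + 180 * ((size (st_agents st))%:R - (size (st_agents st'))%:R)
         + 180 * ((prios (st_agents st))%:R - (prios (st_agents st'))%:R),
      (count (fun y => 90 < y)%R (view i (st_goods st)) + 2 * prios (st_agents st')
         <= 2 * prios (st_agents st) + 1)%N
    & (prios (st_agents st') <= prios (st_agents st))%N].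
Proof.
move=> H vst iA' iNp h180.
elim: H vst iA' => {st st'} [st j st' jA hb hpr H IH vst iA'|st hstop vst iA]; last first.
  split=> //; first by rewrite !subrr; lra.
  have iN : i \in agentsN n by case: vst => _ sA _ _ _; exact: sA.
  have ds : desc (view i (st_goods st)) by apply: desc_view => //; case: vst.
  have := hstop _ iA; rewrite bagval_lt // !big_cons big_nil addr0 /= => h.
  have := count_big_le1 ds; have := ds 0%N 1%N isT => h1 /(_ ltac:(lra)).
  rewrite /prios; move: (count _ _) (count _ _) => *; lia.
have uG := valid_uniq vst.
have vst1 := @valid_give_iota st j 1 2 vst jA hb.
have [h1 h2 h3] := IH vst1 iA'.
have [_ sub _ _] := phase2_spec H vst1.
have iA : i \in st_agents st by have /mem_rem := sub _ iA'.
have iN : i \in agentsN n by case: vst => _ sA _ _ _; exact: sA.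
have ds : desc (view i (st_goods st)) by apply: desc_view => //; case: vst.
have le180 k : (view i (st_goods st))`_k <= 180.
  case: (ltnP k (size (st_goods st))) => hk; last by rewrite nth_default ?size_map.
  rewrite (nth_map 0%N) // h180 //; case: vst => _ _ sG _ _.
  by apply: (mem_subseq sG); exact: mem_nth.
have Esz := size_give (baggoods (st_goods st) [:: 1; 2]%N) jA.
have Epr := count_give (fun j => j \notin Np) (baggoods (st_goods st) [:: 1; 2]%N) jA.
rewrite -!/(prios _) in Epr.
have Esum : \sum_(y <- view i (st_goods st)) y =
    \sum_(y <- drop 2 (view i (st_goods st))) y
    + ((view i (st_goods st))`_0 + (view i (st_goods st))`_1).
  rewrite (@sum_cut _ id 0 2) // /cut take0 /=; congr (_ + _).
  by rewrite !big_ord_recr big_ord0 /= add0r.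
have Ecnt : (count (fun y => 90 < y)%R (view i (st_goods st)) <=
    2 + count (fun y => 90 < y)%R (drop 2 (view i (st_goods st))))%N.
  rewrite -{1}(cat_take_drop 2 (view i (st_goods st))) count_cat leq_add2r.
  by apply: leq_trans (count_size _ _) _; rewrite size_take; case: ltnP.
rewrite drop_goods // view_drop in h1 h2.
have := hpr; rewrite /prio; case: (boolP (j \in Np)) => jNp => [hlt|_].
  have {hlt}: \sum_(p <- [:: 1; 2]%N) (view i (st_goods st))`_p.-1 < 180.
    by rewrite -bagval_lt //; exact: hlt.
  rewrite !big_cons big_nil addr0 /= => h.
  rewrite jNp /= add0n in Epr; rewrite Esz Epr; split=> //.
    by rewrite Esum -[_.+1%:R]natr1; lra.
  (* The two best goods are below 180 together, so at this moment at most one good exceeds 90. *)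
  have := count_big_le1 ds; have := ds 0%N 1%N isT => h4 /(_ ltac:(lra)).
  move: h3; clear; move: (count _ _) (prios _) (prios _) => *; lia.
rewrite jNp /= in Epr; rewrite Esz Epr; split.
- by rewrite Esum -[_.+1%:R]natr1 natrD; have := le180 0%N; have := le180 1%N; lra.
- move: h2 Ecnt; clear; move: (count _ _) (count _ _) (prios _) (prios _) => *; lia.
- by move: h3; clear; move: (prios _) (prios _) => *; lia.
Qed.

Lemma R2pos_iota k : (0 < k)%N -> R2pos k = iota (2 * k).-1 3.
Proof. by case: k => // k _; rewrite /R2pos /= !prednK //; lia. Qed.

Lemma R3pos_iota k : (0 < k)%N -> R3pos k = iota (3 * k - 2) 4.
Proof.
case: k => // k _; rewrite /R3pos.
by have -> : (3 * k.+1)%N = (3 * k).+3 by lia.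
Qed.

Lemma R2_view i G k : (0 < k)%N -> bagval v i G (R2pos k) < 180 * u ->
  (view i G)`_(2 * k.-1) + (view i G)`_(2 * k.-1).+1 + (view i G)`_(2 * k) < 180.
Proof.
move=> k0; rewrite R2pos_iota // bagval_lt; last by rewrite /=; lia.
rewrite !big_cons big_nil addr0 addrA.
suff [-> -> ->] : [/\ (2 * k).-1.-1 = (2 * k.-1)%N, (2 * k).-1.+1.-1 = (2 * k.-1).+1
   & (2 * k).-1.+2.-1 = (2 * k)%N] by [].
by split; lia.
Qed.

Lemma R3_view i G k : (0 < k)%N -> bagval v i G (R3pos k) < 180 * u ->
  (view i G)`_(3 * k.-1) + (view i G)`_(3 * k.-1).+1 + (view i G)`_(3 * k.-1).+2
  + (view i G)`_(3 * k) < 180.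
Proof.
move=> k0; rewrite R3pos_iota // bagval_lt; last by rewrite /=; lia.
rewrite !big_cons big_nil addr0 !addrA.
suff [-> -> -> ->] : [/\ (3 * k - 2).-1 = (3 * k.-1)%N, (3 * k - 2).+1.-1 = (3 * k.-1).+1,
   (3 * k - 2).+2.-1 = (3 * k.-1).+2 & (3 * k - 2).+3.-1 = (3 * k)%N] by [].
by split; lia.
Qed.

Lemma phase3_spec st st' : phase3 v (180 * u) st st' -> valid v n m (180 * u) st ->
  [/\ valid v n m (180 * u) st', {subset st_agents st' <= st_agents st},
      forall i, i \in st_agents st' ->
        reduced (size (st_agents st')) (view i (st_goods st'))
    & forall i, i \in st_agents st' ->
        shrink (size (st_agents st)) (view i (st_goods st))
               (size (st_agents st')) (view i (st_goods st'))].
Proof.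
elim=> {st st'} [st i st' iA hb H IH vst|st i st' hno iA hb H IH vst|st hstop vst].
- have k0 : (0 < size (st_agents st))%N by case: (st_agents st) iA.
  rewrite R2pos_iota // in hb IH.
  have [v' sub red sh] := IH (valid_give_iota vst iA hb).
  split=> //; first by move=> j /sub /mem_rem.
  move=> j jA'; have := sh j jA'; rewrite goods_give_iota ?(valid_uniq vst) //; last lia.
  have := size_give (baggoods (st_goods st) (iota (2 * size (st_agents st)).-1 3)) iA.
  (* The agent [j] is still there afterwards, so the new number of agents is positive, as [shrink]
     demands. *)
  case E : (size (st_agents (give _ _ _))) => [|a] -> sh'.
    by have := sub _ jA'; move: E; case: (st_agents _).
  apply: shrink_R2; rewrite view_cut in sh'.
  by have -> : (2 * a.+1)%N = (2 * a.+2).-1.-1 by lia.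
- have k0 : (0 < size (st_agents st))%N by case: (st_agents st) iA.
  rewrite R3pos_iota // in hb IH.
  have [v' sub red sh] := IH (valid_give_iota vst iA hb).
  split=> //; first by move=> j /sub /mem_rem.
  move=> j jA'; have := sh j jA'; rewrite goods_give_iota ?(valid_uniq vst) //; last lia.
  have jA : j \in st_agents st by have /mem_rem := sub _ jA'.
  have := R2_view k0 (hno _ jA).
  have := size_give (baggoods (st_goods st) (iota (3 * size (st_agents st) - 2) 4)) iA.
  case E : (size (st_agents (give _ _ _))) => [|a] -> hR2 sh'.
    by have := sub _ jA'; move: E; case: (st_agents _).
  apply: shrink_R3; first by move: hR2; have -> : (2 * a.+2)%N = (2 * a.+1).+2 by lia.
  rewrite view_cut in sh'.
  by have -> : (3 * a.+1)%N = (3 * a.+2 - 2).-1 by lia.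
- split=> // i iA; last exact: shrink_refl.
  have k0 : (0 < size (st_agents st))%N by case: (st_agents st) iA.
  by have [h2 h3] := hstop i iA; split; [exact: R2_view|exact: R3_view].
Qed.

End Phases.

(** * Phase 1 *)

Section Phase1.
Variables (R : realFieldType) (v : nat -> nat -> R) (n m : nat) (alpha : R) (Np : seq nat).
(* The index [k] of the bag [B_k] that contains [g], for [1 <= g <= 2 n]. *)
Definition owner g := if (g <= n)%N then g else (2 * n - g).+1.
Definition alive (RB : seq nat) g := (2 * n < g)%N || (owner g \in RB).
Definition alive_goods RB := [seq g <- goodsM m | alive RB g].

Lemma sum_alive (psi : nat -> R) RB : uniq RB -> {subset RB <= iota 1 n} ->
  \sum_(g <- [seq g <- iota 1 (2 * n) | alive RB g]) psi g =
  \sum_(k <- RB) (psi k + psi (2 * n - k).+1).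
Proof.
move=> uRB sRB; rewrite big_filter.
have -> : \sum_(k <- RB) (psi k + psi (2 * n - k).+1) =
    \sum_(k <- iota 1 n | k \in RB) (psi k + psi (2 * n - k).+1).
  rewrite -[RHS]big_filter; apply: perm_big; apply: uniq_perm => //.
    exact: filter_uniq (iota_uniq _ _).
  by move=> k; rewrite mem_filter; case: (boolP (k \in RB)) => //= /sRB ->.
rewrite -[1%N]addn0 !iotaDl !big_map -/(index_iota 0 (2 * n)).
have -> (f : nat -> R) (P : pred nat) l : \sum_(i <- iota 0 l | P i) f i = \sum_(i < l | P i) f i.
  by rewrite -(big_mkord P f) /index_iota subn0.
have -> (f : nat -> R) (P : pred nat) l : \sum_(i <- iota 0 l | P i) f i = \sum_(i < l | P i) f i.
  by rewrite -(big_mkord P f) /index_iota subn0.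
rewrite big_mkcond (sum_fold2 (fun p => if alive RB (1 + p)%N then psi (1 + p)%N else 0)).
rewrite [RHS]big_mkcond; apply: eq_bigr => j _; have hj := ltn_ord j.
have -> : alive RB (1 + j)%N = ((1 + j)%N \in RB).
  by rewrite /alive /owner ifT //; case: ltnP => //; lia.
have -> : alive RB (1 + (2 * n - j.+1))%N = ((1 + j)%N \in RB).
  rewrite /alive /owner ifF; last by lia.
  have -> : ((2 * n - (1 + (2 * n - j.+1))).+1 = 1 + j)%N by lia.
  by case: ltnP => //; lia.
by case: ifP => _; rewrite ?addr0 // !add1n.
Qed.

Lemma size_alive RB : uniq RB -> {subset RB <= iota 1 n} ->
  size [seq g <- iota 1 (2 * n) | alive RB g] = (2 * size RB)%N.
Proof.
(* Constant weight 1 turns the sum into a count. *)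
move=> uRB sRB; have := sum_alive (fun=> 1) uRB sRB.
rewrite !big_const_seq !count_predT !iter_addr !addr0 => /eqP.
by rewrite -mulr2n -mulrnA eqr_nat => /eqP.
Qed.

Hypothesis le2nm : (2 * n <= m)%N.

Lemma Bk_goods k : k \in iota 1 n -> baggoods (goodsM m) (Bk n k) = Bk n k.
Proof.
rewrite mem_iota => hk; rewrite /baggoods /Bk /goodsM /= /Defs.inr /posg size_iota /=.
have -> : ((0 < k) && (k <= m))%N by lia.
have -> : (2 * n - k < m)%N by lia.
by rewrite /= !nth_iota; try lia; congr [:: _; _]; lia.
Qed.

Lemma alive_rem RB k g : uniq RB -> k \in iota 1 n -> g \in goodsM m ->
  (g \notin Bk n k) && alive RB g = alive (rem k RB) g.
Proof.
move=> uRB; rewrite !mem_iota => hk hg; rewrite /alive mem_rem_uniq //.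
have -> : (g \in Bk n k) = (g <= 2 * n)%N && (owner g == k).
  by rewrite !inE /owner; case: (leqP g n); lia.
by rewrite inE leqNgt; case: (2 * n < g)%N.
Qed.

Lemma give_alive st RB i k : uniq RB -> k \in iota 1 n -> st_goods st = alive_goods RB ->
  st_goods (give st i (baggoods (goodsM m) (Bk n k))) = alive_goods (rem k RB).
Proof.
move=> uRB hk E; rewrite /= E Bk_goods // /alive_goods -filter_predI.
by apply: eq_in_filter => g hg /=; exact: alive_rem.
Qed.

Lemma goodsM_split : goodsM m = iota 1 (2 * n) ++ iota (2 * n).+1 (m - 2 * n).
Proof. by rewrite /goodsM -[(2 * n).+1]add1n -iotaD subnKC. Qed.

Lemma alive_goods_split RB :
  alive_goods RB = [seq g <- iota 1 (2 * n) | alive RB g] ++ iota (2 * n).+1 (m - 2 * n).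
Proof.
rewrite /alive_goods goodsM_split filter_cat; congr (_ ++ _).
by apply/all_filterP/allP => g; rewrite mem_iota /alive => /andP[-> _].
Qed.

Lemma sum_alive_goods (psi : nat -> R) RB : uniq RB -> {subset RB <= iota 1 n} ->
  \sum_(g <- alive_goods RB) psi g =
  \sum_(k <- RB) (psi k + psi (2 * n - k).+1)
  + \sum_(g <- iota (2 * n).+1 (m - 2 * n)) psi g.
Proof. by move=> uRB sRB; rewrite alive_goods_split big_cat /= sum_alive. Qed.

Lemma alive_goods_all : alive_goods (iota 1 n) = goodsM m.
Proof.
apply/all_filterP/allP => g; rewrite !mem_iota /alive /owner => hg.
by case: (ltnP (2 * n)) => //= h; rewrite mem_iota; case: ifP; lia.
Qed.

Lemma ival_Bk i k : k \in iota 1 n -> ival v m i (Bk n k) = v i k + v i (2 * n - k).+1.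
Proof. by move=> hk; rewrite /ival /bagval /vS Bk_goods // !big_cons big_nil addr0. Qed.

(** The last clause serves two weights [h] of bags: the value, with [c = d = 180], and the number of
    goods above 90, with [c = d = 1]. The surplus [d] arises only when a priority agent leaves;
    otherwise the bag is worth less than [alpha] to [i]. *)
Lemma phase1_spec RB st st' : phase1 v n m alpha Np RB st st' ->
  valid v n m alpha st -> uniq RB -> {subset RB <= iota 1 n} ->
  st_goods st = alive_goods RB -> size RB = size (st_agents st) ->
  exists RB', [/\ valid v n m alpha st', {subset st_agents st' <= st_agents st},
     [/\ uniq RB', {subset RB' <= RB}, st_goods st' = alive_goods RB'
       & size RB' = size (st_agents st')],
     (forall i k, i \in st_agents st' -> k \in RB' -> ival v m i (Bk n k) < alpha)
   & forall i, i \in st_agents st' -> i \notin Np ->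
     (prios Np (st_agents st') <= prios Np (st_agents st))%N /\
     forall (h : nat -> R) (c d : R),
       (forall k, k \in iota 1 n -> h k <= c + d) ->
       (forall k, k \in iota 1 n -> ival v m i (Bk n k) < alpha -> h k <= c) ->
       \sum_(k <- RB) h k <= \sum_(k <- RB') h k
         + c * ((size RB)%:R - (size RB')%:R)
         + d * ((prios Np (st_agents st))%:R - (prios Np (st_agents st'))%:R)].
Proof.
elim=> {RB st st'} [RB st j k st' jA kRB hb hpr H IH|RB st hstop] vst uRB sRB EG Esz; last first.
  exists RB; split=> //; first by split.
  move=> i iA iNp; split=> // h c d _ _; rewrite !subrr; lra.
have hk := sRB _ kRB.
have subB : {subset baggoods (goodsM m) (Bk n k) <= st_goods st}.
  move=> g; rewrite Bk_goods // EG mem_filter => hg.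
  move: (hk); rewrite mem_iota => hk'; apply/andP; split.
    rewrite /alive; suff -> : owner g = k by rewrite kRB orbT.
    by move: hg; rewrite !inE /owner; case: (leqP g n); lia.
  by rewrite mem_iota; move: hg; rewrite !inE; lia.
have uB : uniq (baggoods (goodsM m) (Bk n k)).
  by apply: uniq_baggoods; [exact: iota_uniq|rewrite /= inE; move: hk; rewrite mem_iota; lia].
have vst1 := valid_give vst jA uB subB hb.
have Esz1 := size_give (baggoods (goodsM m) (Bk n k)) jA.
have sRB1 : {subset rem k RB <= iota 1 n} by move=> k' /mem_rem /sRB.
have szr : size RB = (size (rem k RB)).+1 by rewrite size_rem // prednK //; case: (RB) kRB.
have [||RB' [v' sub [uRB' sRB' EG' Esz'] hst hpri]] := IH vst1 (rem_uniq k uRB) sRB1.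
- exact: give_alive.
- by move: Esz; rewrite Esz1 szr => -[].
have sub' : {subset st_agents st' <= st_agents st} by move=> i /sub /mem_rem.
exists RB'; split=> //; first by split=> // k' /sRB' /mem_rem.
move=> i iA' iNp; have [hle hsum] := hpri i iA' iNp.
have Epr := count_give (fun j => j \notin Np) (baggoods (goodsM m) (Bk n k)) jA.
rewrite -!/(prios _ _) in Epr.
split; first by rewrite Epr; apply: leq_trans hle _; exact: leq_addl.
move=> h c d h1 h2; have := hsum h c d h1 h2.
rewrite (perm_big _ (perm_to_rem kRB)) big_cons Epr szr -[_.+1%:R]natr1 natrD /=.
case: (boolP (j \in Np)) hpr => jNp /=.
  move=> /(_ jNp i (sub' _ iA') iNp) /(h2 k hk) hc H'; rewrite mulrDr in H' *; lra.
by move=> _ H'; have := h1 k hk; lra.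
Qed.

End Phase1.

(** * Phase 4 *)

Section Phase4.
Variables (R : realFieldType) (v : nat -> nat -> R) (n m : nat) (u : R) (Np : seq nat).
Variables (n4 : nat) (G4 : seq nat).
Let Cb := Cbase n4 G4.
Let low := low4 n4 G4.

Lemma sum_Cbase (w : nat -> R) j : \sum_(g <- Cb j.+1) w g =
  (map w G4)`_j + (map w G4)`_(2 * n4 - j.+1) + (map w G4)`_(2 * n4 + j).
Proof.
rewrite sum_baggoods; last by rewrite /= addnS.
by rewrite !big_cons big_nil addr0 addrA addnS.
Qed.

(** The bags partition the first [3 * n4] goods: mirrored pairs cover the first [2 * n4], the third
    goods the rest. *)
Lemma sum_low (w : nat -> R) :
  \sum_(g <- low) w g = \sum_(1 <= j < n4.+1) \sum_(g <- Cb j) w g.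
Proof.
rewrite big_add1 /= big_mkord (eq_bigr _ (fun (j : 'I_n4) _ => sum_Cbase w j)).
rewrite big_split /= -(sum_fold2 (fun p => (map w G4)`_p)).
rewrite -(big_map w xpredT id) /low /low4 map_take sum_take //=.
have -> : (3 * n4 = 2 * n4 + n4)%N by lia.
by rewrite big_split_ord.
Qed.

Hypothesis uG4 : uniq G4.

Lemma uniq_Cbase k : (0 < k <= n4)%N -> uniq (Cb k).
Proof. by move=> hk; apply: uniq_baggoods => //; rewrite /= !inE; lia. Qed.

Lemma mem_Cbase k g : (0 < k <= n4)%N -> g \in Cb k ->
  [/\ g \in G4, (index g G4 < 3 * n4)%N &
      (index g G4 == k.-1) || (index g G4 == 2 * n4 - k)%N || (index g G4 == (2 * n4 + k).-1)].
Proof.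
move=> hk /mem_baggoods[p hp [p0 pG ->]].
have pG' : (p.-1 < size G4)%N by rewrite prednK.
rewrite index_uniq // mem_nth //; move: hp; rewrite !inE => hp.
by split=> //; clear -hk hp p0; lia.
Qed.

Lemma Cbase_low k : (0 < k <= n4)%N -> {subset Cb k <= low}.
Proof.
move=> hk g /(mem_Cbase hk) [gG ig _].
rewrite /low /low4 -(nth_index 0%N gG) -(nth_take 0%N ig) mem_nth // size_take.
by case: (ltnP (3 * n4) (size G4)) => // _; rewrite index_mem.
Qed.

Lemma Cbase_disj k k' g : (0 < k <= n4)%N -> (0 < k' <= n4)%N ->
  g \in Cb k -> g \in Cb k' -> k = k'.
Proof.
move=> hk hk' /(mem_Cbase hk) [_ _ h] /(mem_Cbase hk') [_ _ h'].
by clear -hk hk' h h'; lia.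
Qed.

Definition filling i k F := F = [::] \/ exists F' g, F = rcons F' g /\ vS v i (Cb k ++ F') < 180 * u.

(** That the remaining low goods are split among the bags from [k] on is stated through sums of
    arbitrary weights, the form in which [stuck] needs it. *)
Definition open_bags k st :=
  [/\ valid v n m (180 * u) st, {subset st_goods st <= G4},
      forall j, (k <= j <= n4)%N -> {subset Cb j <= st_goods st},
      forall psi : nat -> R, \sum_(g <- st_goods st | g \in low) psi g =
        \sum_(k <= j < n4.+1) \sum_(g <- Cb j) psi g
    & (size (st_agents st) + k)%N = n4.+1].

Definition current_bag k C st F0 :=
  [/\ C = Cb k ++ F0, uniq C, {subset C <= st_goods st},
      forall g, g \in F0 -> g \notin low
    & forall i, i \in st_agents st -> filling i k F0].

(** The counterpart of [stuck] for goods instead of values, restricted to the bags from [k] on,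
    which are counted from 1. *)
Definition failed i k st := exists F kf,
  [/\ (k <= kf <= n4)%N,
      forall psi : nat -> R, \sum_(g <- st_goods st) psi g =
        \sum_(k <= j < n4.+1) (\sum_(g <- Cb j) psi g + \sum_(g <- F j) psi g),
      forall j, (k <= j <= n4)%N -> filling i j (F j),
      forall j, (k <= j <= n4)%N -> forall g, g \in F j -> g \in G4 /\ g \notin low
    & vS v i (Cb kf ++ F kf) < 180 * u].

Lemma sum_bag_low k C st F0 (psi : nat -> R) : (0 < k <= n4)%N -> current_bag k C st F0 ->
  \sum_(g <- C) (if g \in low then psi g else 0) = \sum_(g <- Cb k) psi g.
Proof.
move=> hk [-> _ _ hF _]; rewrite big_cat /= [X in _ + X]big_seq [X in _ + X]big1; last first.
  by move=> g /hF /negPf ->.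
by rewrite addr0 big_seq [RHS]big_seq; apply: eq_bigr => g /(Cbase_low hk) ->.
Qed.

Lemma give_open k C st F0 i : (0 < k <= n4)%N -> open_bags k st -> current_bag k C st F0 ->
  i \in st_agents st -> 180 * u <= vS v i C ->
  open_bags k.+1 (give st i C) /\
  ((k.+1 <= n4)%N -> current_bag k.+1 (Cb k.+1) (give st i C) [::]).
Proof.
move=> hk [vst sG sC hsum hsz] cb iA hC; case: (cb) => EC uC subC hF hfil.
have sub' j : (k.+1 <= j <= n4)%N -> {subset Cb j <= st_goods (give st i C)}.
  move=> hj g gj; have gC : g \notin C.
    rewrite EC mem_cat negb_or; apply/andP; split; apply/negP.
      move=> gk; have := Cbase_disj hk (k' := j) _ gk gj.
      by clear -hj; lia.
    by move=> /hF; rewrite (Cbase_low _ gj) //; clear -hj; lia.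
  by rewrite /= mem_filter gC (sC j) //; clear -hj; lia.
split.
  split=> //.
  - exact: valid_give.
  - by move=> g /=; rewrite mem_filter => /andP[_ /sG].
  - move=> psi; have := hsum psi.
    rewrite [RHS]big_ltn ?ltnS; last by case/andP: hk.
    rewrite big_mkcond /= (sum_filter_mem _ (valid_uniq vst) uC subC).
    rewrite (sum_bag_low _ hk cb) => /addrI; rewrite -big_mkcond /=.
    by [].
  - by rewrite addnS -addSn -size_give.
move=> hk1; split=> //=; rewrite ?cats0 //.
- by apply: uniq_Cbase; clear -hk1; lia.
- by apply: sub'; clear -hk1; lia.
- by move=> *; left.
Qed.

(** At a failure only the current bag has fillers, and all goods left lie in it or in later bags;
    going back through the run, each given bag adds its own fillers. *)
Lemma phase4_spec k C st out : phase4 v (180 * u) Np n4 G4 k C st out ->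
  (0 < k)%N -> open_bags k st -> ((k <= n4)%N -> exists F0, current_bag k C st F0) ->
  (exists A, out = Success A /\ is_allocation n m A /\
     forall i, i \in agentsN n -> 180 * u <= vS v i (A i)) \/
  exists i, i \in st_agents st /\ failed i k st.
Proof.
elim=> {k C st out} [k C st|k C st g out|k C st|k C st i out] hk.
- move=> k0 [vst _ _ _ hsz] _; left; exists (st_alloc st); split=> //.
  by apply: valid_done vst _; apply: size0nil; lia.
- move=> hlt gG glow gC _ IH k0 ob /(_ hk) [F0 [EC uC subC hF hfil]].
  apply: IH => // _; exists (rcons F0 g); split.
  + by rewrite EC rcons_cat.
  + by rewrite rcons_uniq gC.
  + by move=> h; rewrite mem_rcons inE => /predU1P[->|/subC].
  + by move=> h; rewrite mem_rcons inE => /predU1P[->|/hF].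
  + by move=> i iA; right; exists F0, g; rewrite -EC; split=> //; exact: hlt.
- move=> hlt hex k0 [vst sG sC hsum hsz] /(_ hk) [F0 cb]; right.
  case: (cb) => EC uC subC hF hfil.
  case EA : (st_agents st) => [|i A]; first by move: hsz; rewrite EA /=; lia.
  have iA : i \in st_agents st by rewrite EA mem_head.
  exists i; split; first by rewrite mem_head.
  exists (fun j => if j == k then F0 else [::]), k; rewrite eqxx; split=> //.
  + by rewrite leqnn.
  + move=> psi; rewrite (bigID (fun g => g \in low)) /= hsum big_split /=; congr (_ + _).
    rewrite [RHS]big_ltn ?ltnS // eqxx [X in _ + X]big_nat_cond [X in _ + X]big1; last first.
      move=> j; rewrite andbT => hj; rewrite ifF ?big_nil //; lia.
    rewrite addr0 -big_filter; apply: perm_big; apply: uniq_perm.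
    * exact: filter_uniq (valid_uniq vst).
    * by move: uC; rewrite EC cat_uniq => /and3P[].
    move=> g; rewrite mem_filter; apply/andP/idP => [[glow gG]|gF].
      have := hex g gG glow; rewrite EC mem_cat => /orP[gk|//].
      by move: glow; rewrite -/low (Cbase_low _ gk) ?k0.
    by split; [exact: hF|apply: subC; rewrite EC mem_cat gF orbT].
  + by move=> j hj; case: eqP => [->|_]; [exact: hfil|left].
  + move=> j hj g; case: eqP => // _ gF; split; last exact: hF.
    by apply: sG; apply: subC; rewrite EC mem_cat gF orbT.
  + by rewrite -EC; exact: hlt.
- move=> iA hC _ _ IH k0 ob /(_ hk) [F0 cb].
  have hk' : (0 < k <= n4)%N by rewrite k0.
  have [ob' cb'] := give_open hk' ob cb iA hC.
  have [//|hk1|[A hA]|[j [jA' [F [kf [h1 h2 h3 h4 h5]]]]]] := IH _ ob' _.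
  + by exists [::]; exact: cb'.
  + by left; exists A.
  right; exists j.
  have jA : j \in st_agents st by exact: mem_rem jA'.
  case: (ob) => vst sG _ _ _; case: (cb) => EC uC subC hF hfil.
  split=> //; exists (fun l => if l == k then F0 else F l), kf; split.
  + by clear -h1; lia.
  + move=> psi; rewrite (sum_filter_mem _ (valid_uniq vst) uC subC).
    rewrite big_ltn ?ltnS // eqxx {1}EC big_cat /=; congr (_ + _).
    rewrite (h2 psi); apply: eq_big_nat => l hl; rewrite ifF //; clear -hl; lia.
  + move=> l hl; case: eqP => [->|/eqP nk]; first exact: hfil.
    by apply: h3; clear -hl nk; lia.
  + move=> l hl g; case: eqP => [_ gF|/eqP nk]; last by apply: h4; clear -hl nk; lia.
    by split; [apply: sG; apply: subC; rewrite EC mem_cat gF orbT|exact: hF].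
  + by rewrite ifF //; clear -h1; lia.
Qed.

Hypothesis u_gt0 : 0 < u.
Hypotheses (v_ge0 : nonneg_vals v n m) (v_ord : ordered v n m).

Lemma nth_map0 (x : nat -> R) (psi : R -> R) p : psi 0 = 0 ->
  (map (psi \o x) G4)`_p = psi (map x G4)`_p.
Proof.
move=> psi0; rewrite map_comp; case: (ltnP p (size (map x G4))) => hp.
  by rewrite (nth_map 0).
by rewrite !nth_default ?size_map // -(size_map x).
Qed.

Lemma failed_stuck i st : valid v n m (180 * u) st -> st_goods st = G4 ->
  i \in st_agents st -> failed i 1 st ->
  exists F kf, stuck n4 (view v u i G4) F kf.
Proof.
move=> vst EG iA [F [kf [h1 h2 h3 h4 h5]]].
have iN : i \in agentsN n by case: vst => _ sA _ _ _; exact: sA.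
have ds : desc (view v u i G4).
  by apply: (desc_view u_gt0 v_ge0 v_ord iN); rewrite -EG; case: vst.
have Eb F' j : vS v i (Cb j.+1 ++ F') =
    u * (base n4 (view v u i G4) j + \sum_(y <- view v u i F') y).
  by rewrite (vS_view v u_gt0) big_cat /= sum_Cbase /base big_map.
exists (fun j => if (j < n4)%N then view v u i (F j.+1) else [::]), kf.-1.
have kfn : (kf.-1 < n4)%N by lia.
split=> //.
- move=> psi psi0; rewrite /view big_map -EG (h2 (fun g => psi (v i g / u))).
  rewrite big_add1 /= big_mkord; apply: eq_bigr => j _.
  rewrite /bagsum ltn_ord [X in _ = _ + X]big_map; congr (_ + _).
  by rewrite -[LHS]/(\sum_(g <- Cb j.+1) (psi \o (fun g => v i g / u)) g) sum_Cbase !nth_map0 // EG.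
- move=> j jn; rewrite jn; case: (h3 j.+1 jn) => [->|[F' [g [-> h]]]]; [by left|right].
  exists (view v u i F'), (v i g / u); rewrite /view map_rcons; split=> //.
  by move: h; rewrite Eb [180 * u]mulrC ltr_pM2l.
- move=> j y; case: ltnP => // jn /mapP[g gF ->].
  have [gG glow] := h4 j.+1 jn g gF.
  have -> : v i g / u = (view v u i G4)`_(index g G4).
    by rewrite (nth_map 0%N) ?index_mem // nth_index.
  (* A filler is not among the first [3 * n4] goods, so it stands at position [3 * n4] or later,
     counted from 0. *)
  rewrite (desc_ge0 _ ds) /=; apply: ds; rewrite leqNgt; apply/negP => hi.
  move/negP: glow; apply; rewrite /low /low4 -(nth_index 0%N gG) -(nth_take 0%N hi).
  by rewrite mem_nth // size_take; case: (ltnP (3 * n4) (size G4)) => // _; rewrite index_mem.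
- have {}h5 : vS v i (Cb kf.-1.+1 ++ F kf.-1.+1) < 180 * u by rewrite prednK //; case/andP: h1.
  by move: h5; rewrite Eb [180 * u]mulrC ltr_pM2l // /bagsum kfn.
Qed.

End Phase4.

(** * An agent left over in phase 4 *)

Lemma sum_bundles (R : realFieldType) (psi : nat -> R) n S P : is_partition n S P ->
  \sum_(g <- S) psi g = \sum_(k < n) \sum_(g <- bundle P S k) psi g.
Proof.
move=> hP; under [RHS]eq_bigr => k _ do rewrite big_filter big_mkcond.
rewrite exchange_big /= big_seq [RHS]big_seq; apply: eq_bigr => g gS.
rewrite (bigD1 (Ordinal (hP g gS))) //= eqxx big1 ?addr0 // => k hk.
by rewrite ifF //; apply: contraNF hk => /eqP E; apply/eqP/val_inj.
Qed.

Lemma sum_cst (R : realFieldType) (T : Type) (c : R) (s : seq T) :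
  \sum_(k <- s) c = c * (size s)%:R.
Proof. by rewrite big_const_seq count_predT iter_addr addr0 mulr_natr. Qed.

Lemma sum_le_sub (R : realFieldType) (h : nat -> R) (c : R) (S S' : seq nat) :
  uniq S -> uniq S' -> {subset S' <= S} -> (forall k, k \in S -> h k <= c) ->
  \sum_(k <- S) h k <= \sum_(k <- S') h k + c * ((size S)%:R - (size S')%:R).
Proof.
move=> uS uS' sub hc; rewrite (sum_filter_mem h uS uS' sub) lerD2l.
have := sum_filter_mem (fun=> 1 : R) uS uS' sub.
rewrite !sum_cst !mul1r => ->.
rewrite addrC addKr -sum_cst big_seq [leRHS]big_seq.
by apply: ler_sum => k; rewrite mem_filter => /andP[_ /hc].
Qed.

Section Main.
Variables (R : realFieldType) (n m : nat) (v : nat -> nat -> R) (u eta : R) (Np : seq nat).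
Hypothesis u_gt0 : 0 < u.
Hypotheses (v_ge0 : nonneg_vals v n m) (v_ord : ordered v n m).
Hypothesis v_irr : irreducible v n m (180 * u).

Notation x i := (fun g => v i g / u).
Notation s0 i := (view v u i (goodsM m)).

Lemma desc_s0 i : i \in agentsN n -> desc (s0 i).
Proof. by move=> iN; apply: (desc_view u_gt0 v_ge0 v_ord iN). Qed.

Lemma mem_s0_le i y : i \in agentsN n -> y \in s0 i -> 0 <= y <= (s0 i)`_0.
Proof.
move=> iN /(nthP 0)[p _ <-]; have ds := desc_s0 iN.
by rewrite (desc_ge0 _ ds) ds.
Qed.

Lemma agents_gt0 i : i \in agentsN n -> (0 < n)%N.
Proof. by rewrite mem_iota; lia. Qed.

Lemma irr_s0 i : i \in agentsN n ->
  [/\ (s0 i)`_0 < 180, (s0 i)`_(2 * n) < 60 & (s0 i)`_0 + (s0 i)`_(2 * n) < 180].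
Proof.
move=> iN; have n0 := agents_gt0 iN; have [h1 h2 _ h4] := v_irr iN.
have ds := desc_s0 iN.
move: h1; rewrite /ival bagval_lt // big_cons big_nil addr0 => h1.
move: h4; rewrite /ival bagval_lt // !big_cons big_nil addr0 => h4.
have := R2_view u_gt0 n0 h2 => h2'.
split=> //.
have := ds (2 * n.-1)%N (2 * n)%N; have := ds (2 * n.-1).+1 (2 * n)%N.
by move=> /(_ ltac:(clear -n0; lia)) h5 /(_ ltac:(clear -n0; lia)) h6; lra.
Qed.

Hypotheses (eta_ge0 : 0 <= eta) (eta_le1 : eta <= 1).
Hypotheses (one_eq : 1 = (240 - eta) * u) (v_norm : normalized v n m).

(** Summation over the [n] bundles of an MMS partition of [i], each of which is worth [240 - eta]
    units. *)
Lemma bundles_cover i (psi : R -> R) c : i \in agentsN n ->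
  (forall s : seq R, (forall y, y \in s -> y \in s0 i) ->
     \sum_(y <- s) y = 240 - eta -> c <= \sum_(y <- s) psi y) ->
  c * n%:R <= \sum_(y <- s0 i) psi y.
Proof.
move=> iN hc; have [P [[hP _] hb]] := v_norm iN.
rewrite big_map (sum_bundles (fun g => psi (v i g / u)) hP).
rewrite mulr_natr -[X in _ *+ X]card_ord -sumr_const; apply: ler_sum => k _.
have := hc (view v u i (bundle P (goodsM m) k)); rewrite /view !big_map; apply.
  by move=> y /mapP[g]; rewrite mem_filter => /andP[_ gM] ->; exact: map_f.
apply: (mulfI (lt0r_neq0 u_gt0)); rewrite -(vS_view v u_gt0) [RHS]mulrC -one_eq.
exact: hb.
Qed.

Lemma sum_s0 i : i \in agentsN n -> \sum_(y <- s0 i) y = (240 - eta) * n%:R.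
Proof.
move=> iN; apply/eqP; rewrite eq_le; apply/andP; split; last first.
  by apply: bundles_cover => // s _ ->.
(* The opposite bound comes from the negated values. *)
have := @bundles_cover i (fun y => - y) (- (240 - eta)) iN; rewrite sumrN mulNr lerN2.
by apply=> s _ h; rewrite sumrN h.
Qed.

(** A single good is below 180 and cannot form a bundle, so each of the [n] bundles has at least two
    goods. *)
Lemma le2nm : (2 * n <= m)%N.
Proof.
case: (posnP n) => [->//|n0]; have iN : 1%N \in agentsN n by rewrite mem_iota; lia.
have [h180 _ _] := irr_s0 iN.
have := @bundles_cover _ (fun=> 1) 2 iN; rewrite sum_cst mul1r.
rewrite size_map size_iota -natrM ler_nat; apply=> s hs hsum.
rewrite sum_cst mul1r ler_nat.
case: s hs hsum => [|y [|z s]] // hs; rewrite ?big_nil ?big_cons ?big_nil => hsum.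
  by exfalso; move: eta_le1; lra.
have /andP[_ hy] := mem_s0_le iN (hs y (mem_head _ _)).
by exfalso; move: eta_le1; lra.
Qed.

Lemma view_alive i RB : uniq RB -> {subset RB <= iota 1 n} ->
  [/\ forall psi : R -> R, psi 0 = 0 -> psum psi (view v u i (alive_goods n m RB)) (2 * size RB)
        = \sum_(k <- RB) (psi (x i k) + psi (x i (2 * n - k).+1))
    & (view v u i (alive_goods n m RB))`_(2 * size RB) = (s0 i)`_(2 * n)].
Proof.
move=> uRB sRB; have E := alive_goods_split le2nm RB.
have sz := size_alive R uRB sRB; split=> [psi psi0|].
  rewrite /psum -(sum_take _ _ psi0) E /view map_cat take_cat size_map sz ltnn subnn take0 cats0.
  by rewrite big_map (sum_alive (fun g => psi (x i g)) uRB sRB).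
rewrite E (goodsM_split le2nm) /view !map_cat !nth_cat !size_map sz size_iota.
by rewrite !ltnn !subnn.
Qed.

Lemma sum_view_alive i RB (psi : R -> R) : uniq RB -> {subset RB <= iota 1 n} ->
  \sum_(y <- view v u i (alive_goods n m RB)) psi y =
  \sum_(k <- RB) (psi (x i k) + psi (x i (2 * n - k).+1))
  + \sum_(g <- iota (2 * n).+1 (m - 2 * n)) psi (x i g).
Proof.
by move=> uRB sRB; rewrite big_map (sum_alive_goods le2nm (fun g => psi (x i g))).
Qed.

Lemma sum_s0_split i (psi : R -> R) : \sum_(y <- s0 i) psi y =
  \sum_(k <- iota 1 n) (psi (x i k) + psi (x i (2 * n - k).+1))
  + \sum_(g <- iota (2 * n).+1 (m - 2 * n)) psi (x i g).
Proof.
by rewrite -{1}(alive_goods_all le2nm) sum_view_alive // iota_uniq.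
Qed.

Lemma view_le_s0 i G p : i \in agentsN n -> subseq G (goodsM m) ->
  (view v u i G)`_p <= (s0 i)`_0.
Proof.
move=> iN sG; case: (ltnP p (size G)) => hp.
  suff /(mem_s0_le iN)/andP[] : (view v u i G)`_p \in s0 i by [].
  by rewrite (nth_map 0%N) //; apply/(map_f (x i))/(mem_subseq sG)/mem_nth.
rewrite nth_default ?size_map //; exact: desc_ge0 (desc_s0 iN).
Qed.

Lemma xpair i k : k \in iota 1 n ->
  ival v m i (Bk n k) = u * (x i k + x i (2 * n - k).+1).
Proof.
move=> hk; rewrite (ival_Bk _ le2nm) // -mulrDl mulrCA divff ?mulr1 //.
exact: lt0r_neq0.
Qed.

Lemma x_le_s0 i k : i \in agentsN n -> k \in iota 1 m -> x i k <= (s0 i)`_0.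
Proof.
by move=> iN kM; have /andP[] := mem_s0_le iN (map_f (x i) kM).
Qed.

Lemma xmem k : k \in iota 1 n -> k \in iota 1 m /\ (2 * n - k).+1 \in iota 1 m.
Proof. by rewrite !mem_iota; have := le2nm; clear; lia. Qed.

(** * Contradiction from a failed run *)

Section Failure.
Variables (st1 st2 st3 : state) (RB : seq nat) (b i : nat) (F : nat -> seq R) (kf : nat).
Hypotheses (uRB : uniq RB) (sRB : {subset RB <= iota 1 n}).
Hypotheses (v1 : valid v n m (180 * u) st1) (E1 : st_goods st1 = alive_goods n m RB)
  (sz1 : size RB = size (st_agents st1))
  (stop1 : forall k, k \in RB -> ival v m i (Bk n k) < 180 * u).
Hypotheses (E2 : st_goods st2 = drop (2 * b) (st_goods st1))
  (sz2 : size (st_agents st1) = (size (st_agents st2) + b)%N)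
  (stop2 : (view v u i (st_goods st2))`_0 + (view v u i (st_goods st2))`_1 < 180).
Hypotheses (iA2 : i \in st_agents st2) (iN : i \in agentsN n).
Let n1 := size (st_agents st1).
Let n2 := size (st_agents st2).
Let n3 := size (st_agents st3).
Let s1 := view v u i (st_goods st1).
Let s2 := view v u i (st_goods st2).
Let s3 := view v u i (st_goods st3).
Hypotheses (sh : shrink n2 s2 n3 s3) (red : reduced n3 s3) (stk : stuck n3 s3 F kf).

Lemma n2_gt0 : (0 < n2)%N.
Proof. by rewrite /n2; case: (st_agents st2) iA2. Qed.

Lemma s1_2n1 : s1`_(2 * n1) = (s0 i)`_(2 * n).
Proof. by have [_] := view_alive i uRB sRB; rewrite -E1 sz1. Qed.

Lemma s2_drop : s2 = drop (2 * b) s1.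
Proof. by rewrite /s2 E2 view_drop. Qed.

Lemma s2_2n2 : s2`_(2 * n2) = (s0 i)`_(2 * n).
Proof. by rewrite s2_drop nth_drop -s1_2n1 /n1 sz2 /n2 mulnDr addnC. Qed.

Lemma desc_s1 : desc s1.
Proof. by apply: (desc_view u_gt0 v_ge0 v_ord iN); case: v1. Qed.

Lemma desc_s2 : desc s2.
Proof. by move=> p q pq; rewrite s2_drop !nth_drop; apply: desc_s1; rewrite leq_add2l. Qed.

(** If no bag [B_k] weighs more than [c], giving bags away in phase 1 cannot push the average weight
    per remaining agent below [c]. *)
Lemma s1_ge (psi : R -> R) c :
  (forall k, k \in iota 1 n -> psi (x i k) + psi (x i (2 * n - k).+1) <= c) ->
  c * n%:R <= \sum_(y <- s0 i) psi y -> c * n1%:R <= \sum_(y <- s1) psi y.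
Proof.
move=> hc; rewrite sum_s0_split /s1 E1 sum_view_alive //.
have := sum_le_sub (iota_uniq 1 n) uRB sRB hc; rewrite size_iota sz1 -/n1; lra.
Qed.

(** In N^1_1 no [B_k] is worth more than 1, so phase 1 keeps the average at [240 - eta]. Goods are
    at most 124 because goods 1 and [2 n + 1] are together below 180. *)
Lemma nonpriority_absurd : inN1 v n m i -> 56 <= (s0 i)`_(2 * n) -> False.
Proof.
move=> hN1 h56; have [h180 h60 h0] := irr_s0 iN.
have h124 : (s0 i)`_0 <= 124 by lra.
have mem124 s : (forall y, y \in s -> y \in s0 i) -> forall y, y \in s -> 0 <= y <= 124.
  by move=> hs y /hs /(mem_s0_le iN) /andP[-> h] /=; lra.
apply: (@nonpriority_not_stuck R (240 - eta) n1 b n3 s1 s3 F kf).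
- move: eta_le1; lra.
- exact: desc_s1.
- by apply: le_trans h124; apply: view_le_s0 => //; case: v1.
- by rewrite s1_2n1.
- by rewrite s1_2n1.
- by rewrite /n1 sz2 -{1}[b]add0n ltn_add2r n2_gt0.
- apply: (@s1_ge id) => [k hk|]; last by rewrite /= sum_s0.
  by rewrite -(ler_pM2l u_gt0) -xpair // [leRHS]mulrC -one_eq; exact: (allP hN1).
- rewrite /n1 -sz1 /s1 E1; have [-> // _] := view_alive i uRB sRB.
  rewrite -sum_cst big_seq [leRHS]big_seq; apply: ler_sum => k hk.
  have := stop1 hk; rewrite xpair ?sRB // [ltRHS]mulrC ltr_pM2l //; exact: ltW.
- apply: s1_ge => [k hk|].
    by have := phi_low_le3 (x i k); have := phi_low_le3 (x i (2 * n - k).+1); lra.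
  apply: bundles_cover => // s hs E; apply: phi_low_cover; [exact: mem124|rewrite E; move: eta_le1; lra].
- apply: s1_ge => [k hk|].
    by have := phi_high_le110 (x i k); have := phi_high_le110 (x i (2 * n - k).+1); lra.
  apply: bundles_cover => // s hs E; apply: phi_high_cover; [exact: mem124|rewrite E; move: eta_le1; lra].
- by rewrite -s2_drop.
- rewrite -s2_drop; have -> : (n1 - b)%N = n2 by rewrite /n1 sz2 addnK.
  exact: sh.
- exact: red.
- exact: stk.
Qed.

Hypothesis iNp : i \notin Np.
Let p0 := prios Np (agentsN n).
Let p1 := prios Np (st_agents st1).
Let p2 := prios Np (st_agents st2).
Hypothesis few : 60 * p0%:R < eta * n%:R.
Hypotheses (p10 : (p1 <= p0)%N) (p21 : (p2 <= p1)%N).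
Hypothesis ph1 : forall (h : nat -> R) (c d : R),
  (forall k, k \in iota 1 n -> h k <= c + d) ->
  (forall k, k \in iota 1 n -> ival v m i (Bk n k) < 180 * u -> h k <= c) ->
  \sum_(k <- iota 1 n) h k <= \sum_(k <- RB) h k
    + c * (n%:R - n1%:R) + d * (p0%:R - p1%:R).
Hypothesis ph2 : \sum_(y <- s1) y <= \sum_(y <- s2) y
  + 180 * (n1%:R - n2%:R) + 180 * (p1%:R - p2%:R).
Hypothesis ph2big : (count (fun y => 90 < y)%R s1 + 2 * p2 <= 2 * p1 + 1)%N.

(** Phases 1 and 2 cost at most 180 per bag and 180 more per departing priority agent; phases 3 and
    4 cost at most [180 + tau] per bag. *)
Lemma priority_sum tau : 56 <= tau <= 60 -> (s0 i)`_(2 * n) <= tau ->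
  (240 - eta) * n%:R <= 180 * n%:R + 180 * p0%:R + tau * n2%:R.
Proof.
move=> ht hs; have [h180 _ _] := irr_s0 iN.
have := shrink_stuck_sum ht desc_s2 n2_gt0 stop2 _ sh red stk.
rewrite s2_2n2 => /(_ hs) h34; move: ph2.
rewrite -(sum_s0 iN) (sum_s0_split i id) /s1 E1 (@sum_view_alive i RB id) //= => h2.
have ub k : k \in iota 1 n -> x i k + x i (2 * n - k).+1 <= 180 + 180.
  by move=> /xmem[m1 m2]; have := x_le_s0 iN m1; have := x_le_s0 iN m2; lra.
have ub' k : k \in iota 1 n -> ival v m i (Bk n k) < 180 * u ->
    x i k + x i (2 * n - k).+1 <= 180.
  by move=> hk; rewrite xpair // [ltRHS]mulrC ltr_pM2l // => /ltW.
have h1 := @ph1 _ _ _ ub ub'.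
have : 0 <= p2%:R :> R by [].
have : p2%:R <= p1%:R :> R by rewrite ler_nat.
by move: h1 h2 h34; rewrite mulrDl; lra.
Qed.

Lemma priority_absurd : ~~ (inN1 v n m i && (60 - 4 * eta <= (s0 i)`_(2 * n))) -> False.
Proof.
have [h180 h60 h0] := irr_s0 iN; have n0 := agents_gt0 iN.
have n1R : 1 <= n%:R :> R by rewrite ler1n.
have n21 : n2%:R <= n1%:R :> R by rewrite ler_nat /n1 sz2 leq_addr.
have n1n : n1%:R <= n%:R :> R.
  by rewrite ler_nat /n1 -sz1 -(size_iota 1 n); exact: uniq_leq_size.
have en : eta * n%:R <= 1 * n%:R by rewrite ler_wpM2r.
rewrite negb_and -ltNge; case: (ltP (s0 i)`_(2 * n) (60 - 4 * eta)) => hlow.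
  (* What is missing is at least [3 eta n], whereas [few] gives [180 p0 < 3 eta n]. *)
  move=> _; have := @priority_sum (60 - 4 * eta) ltac:(move: eta_le1 eta_ge0; lra) (ltW hlow).
  have : (60 - 4 * eta) * n2%:R <= (60 - 4 * eta) * n%:R.
    by rewrite ler_wpM2l //; move: eta_le1; lra.
  by move: few; rewrite !mulrBl; lra.
rewrite orbF => /allPn[k hk]; rewrite -ltNge [X in X < _]one_eq xpair // mulrC ltr_pM2l // => hbig.
have e1 := eta_le1; have e0 := eta_ge0.
have [m1 m2] := xmem hk; have c1 := x_le_s0 iN m1.
(* Good 1 is below [120 + 4 eta], so the second good of [B_k], which stands at position [n] or
   later, is above [120 - 5 eta]. *)
have bign : 90 < (s0 i)`_n.
  have : x i (2 * n - k).+1 <= (s0 i)`_n.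
    have -> : x i (2 * n - k).+1 = (s0 i)`_(2 * n - k).
      move: m2; rewrite mem_iota => m2; rewrite (nth_map 0%N) ?size_iota ?nth_iota ?add1n //; lia.
    by apply: (desc_s0 iN); move: hk; rewrite mem_iota; clear; lia.
  lra.
pose big (y : R) : R := (90 < y)%R%:R.
have big0 : big 0 = 0 by rewrite /big; case: ltP => //; lra.
have many : n%:R + 1 <= \sum_(y <- s0 i) big y.
  rewrite -(cat_take_drop n.+1 (s0 i)) big_cat /= sum_take //.
  apply: (@le_trans _ _ (\sum_(p < n.+1) 1)).
    by rewrite sumr_const card_ord natr1.
  rewrite -[leLHS]addr0; apply: lerD; last by rewrite sumr_ge0 // => y _; rewrite /big; case: ltP.
  apply: ler_sum => p _; rewrite /big.
  have := desc_s0 iN (p := p) (q := n) ltac:(have := ltn_ord p; clear; lia).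
  by case: ltP => //; lra.
have cnt : \sum_(y <- s1) big y = (count (fun y => 90 < y)%R s1)%:R.
  by rewrite -sum1_count natr_sum [RHS]big_mkcond; apply: eq_bigr => y _; rewrite /big; case: ltP.
have bigP y : big y = 1 /\ 90 < y \/ big y = 0 /\ y <= 90.
  by rewrite /big; case: (ltP 90 y) => h; [left|right].
have ub k' : k' \in iota 1 n -> big (x i k') + big (x i (2 * n - k').+1) <= 1 + 1.
  by move=> _; case: (bigP (x i k')) => -[-> _]; case: (bigP (x i (2 * n - k').+1)) => -[-> _]; lra.
have ub' k' : k' \in iota 1 n -> ival v m i (Bk n k') < 180 * u ->
    big (x i k') + big (x i (2 * n - k').+1) <= 1.
  move=> hk'; rewrite xpair // [ltRHS]mulrC ltr_pM2l //.
  by case: (bigP (x i k')) => -[-> ?]; case: (bigP (x i (2 * n - k').+1)) => -[-> ?]; lra.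
have h1 := @ph1 _ _ _ ub ub'.
move: many cnt; rewrite sum_s0_split /s1 E1 sum_view_alive // => many cnt.
have : (count (fun y => 90 < y)%R s1)%:R + 2 * p2%:R <= 2 * p1%:R + 1 :> R.
  by rewrite -!natrM -!natrD -[1]/(1%:R) -?natrD ler_nat.
rewrite /s1 E1 => hc.
(* Counting the [n + 1] goods above 90 gives [n1 <= p0 + p1 - 2 p2 <= 2 p0]. With [n2 <= n1] the
   total is at most [180 n + 300 p0 < (180 + 5 eta) n], too little for [eta <= 1]. *)
have := @priority_sum 60 ltac:(lra) (ltW h60).
have : p1%:R <= p0%:R :> R by rewrite ler_nat.
have : 0 <= p2%:R :> R by [].
by move: few; rewrite mulrBl; lra.
Qed.

End Failure.
End Main.

(** * From bundles worth the threshold to an approximate MMS allocation *)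

Lemma MMS_value_le1 (R : realFieldType) (v : nat -> nat -> R) n m i y :
  normalized v n m -> i \in agentsN n ->
  is_MMS_value (vS v i) n (goodsM m) y -> y <= 1.
Proof.
move=> hnorm iN [P [[hP _] [hy _]]]; have [Q [[hQ _] hQ1]] := hnorm i iN.
have n0 : (0 < n)%N by move: iN; rewrite mem_iota; lia.
(* The least bundle is at most the average one, and the normalized partition gives the total [n]. *)
have tot : \sum_(g <- goodsM m) v i g = n%:R.
  rewrite (sum_bundles (v i) hQ) (eq_bigr (fun=> 1)) ?sumr_const ?card_ord // => k _.
  exact: hQ1.
have : y * n%:R <= n%:R.
  rewrite -{2}tot (sum_bundles (v i) hP) mulr_natr -[X in _ *+ X]card_ord -sumr_const.
  by apply: ler_sum => k _; exact: hy.
by rewrite -{2}[n%:R]mul1r ler_pM2r // ltr0n.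
Qed.

Lemma valid_init (R : realFieldType) (v : nat -> nat -> R) n m alpha :
  valid v n m alpha (init_state n m).
Proof.
by split=> //= [|j ->]; [exact: iota_uniq|].
Qed.

Lemma prios_count (a : pred nat) (A : seq nat) :
  (prios [seq i <- A | a i] A + size [seq i <- A | a i] = size A)%N.
Proof.
rewrite size_filter -(count_predC a A) addnC; congr (_ + _)%N.
by apply: eq_in_count => i iA /=; rewrite mem_filter iA andbT.
Qed.

Theorem theorem45 (R : realFieldType) (n m : nat) (v : nat -> nat -> R)
    (delta : R) :
  0 <= delta -> delta <= 3 / 956 ->
  ONI v n m delta ->
  (size (N11 v n m delta))%:R > n%:R * (1 / 4 - delta) / (1 / 4 + delta / 3) ->
  forall out, approxMMS2 v n m delta out ->
    exists A, out = Success A /\ is_allocation n m A /\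
              is_beta_MMS v n m (3 / 4 + delta) A.
Proof.
move=> d0 d1 [v_ge0 v_ord v_norm v_irr] hN11 out.
pose u : R := (1 / 4 + delta / 3) / 60.
have u_gt0 : 0 < u by rewrite /u; lra.
pose eta : R := 4 * delta / 3 / u.
have etaE : eta * u = 4 * delta / 3 by rewrite divfK // lt0r_neq0.
have eta_ge0 : 0 <= eta by rewrite divr_ge0 ?(ltW u_gt0) //; lra.
(* The bound [delta <= 3 / 956] is exactly [eta <= 1]. *)
have eta_le1 : eta <= 1 by rewrite ler_pdivrMr // /u; lra.
have one_eq : 1 = (240 - eta) * u by rewrite mulrBl etaE /u; lra.
have alphaE : 3 / 4 + delta = 180 * u by rewrite /u; lra.
rewrite /approxMMS2 alphaE in v_irr *.
set Np := N11 v n m delta in hN11 *.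
have l2nm := le2nm u_gt0 v_ge0 v_ord v_irr eta_ge0 eta_le1 one_eq v_norm.
case=> st1 [st2 [st3 [H1 H2 H3 H4]]].
have [RB [v1 sub1 [uRB sRB E1 sz1] stop1 pr1]] :=
  phase1_spec l2nm H1 (valid_init v n m _) (iota_uniq 1 n) (fun k hk => hk)
    (esym (alive_goods_all l2nm)) erefl.
have [v2 sub2 stop2 [b [E2 sz2]]] := phase2_spec u_gt0 H2 v1.
have [v3 sub3 red sh] := phase3_spec u_gt0 H3 v2.
set n3 := size (st_agents st3) in H4.
have uG3 := valid_uniq v3.
have open3 : open_bags v n m u n3 (st_goods st3) 1 st3.
  split=> //.
  - by move=> j _; exact: baggoods_sub.
  - move=> psi; rewrite -(sum_low n3 (st_goods st3) psi) -big_filter; apply: perm_big.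
    apply: uniq_perm; [exact: filter_uniq|exact: take_uniq|move=> g].
    by rewrite mem_filter; case: (boolP (g \in low4 _ _)) => // /mem_take ->.
  - by rewrite addn1.
have cur3 : (1 <= n3)%N ->
    exists F0, current_bag v u n3 (st_goods st3) 1 (Cbase n3 (st_goods st3) 1) st3 F0.
  move=> n30; exists [::]; split=> //=; rewrite ?cats0 //.
  - exact: uniq_Cbase.
  - exact: baggoods_sub.
  - by move=> *; left.
have [[A [-> [hA hval]]]|[i [iA fl]]] := phase4_spec uG3 H4 isT open3 cur3.
  exists A; split=> //; split=> // i iN y hy.
  apply: le_trans (hval i iN).
  have : 180 * u * y <= 180 * u * 1.
    by rewrite ler_pM2l ?(MMS_value_le1 v_norm iN hy) // mulr_gt0.
  by rewrite mulr1.
exfalso.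
have [F [kf stk]] := failed_stuck uG3 u_gt0 v_ge0 v_ord v3 erefl iA fl.
have iA2 := sub3 _ iA; have iA1 := sub2 _ iA2.
have iN : i \in agentsN n by case: v1 => _ sA _ _ _; exact: sA.
have ivalE : ival v m i [:: (2 * n).+1]%N = u * (view v u i (goodsM m))`_(2 * n).
  by rewrite /ival (bagval_view v u_gt0) // big_cons big_nil addr0.
have thrE : 1 / 4 - 5 * delta = u * (60 - 4 * eta).
  by rewrite mulrBr mulrCA [u * eta]mulrC etaE /u; lra.
have iNpE : (i \in Np) = inN1 v n m i && (60 - 4 * eta <= (view v u i (goodsM m))`_(2 * n)).
  by rewrite mem_filter iN andbT ivalE thrE ler_pM2l.
have st1i k : k \in RB -> ival v m i (Bk n k) < 180 * u by exact: stop1.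
case: (boolP (i \in Np)) => iNp.
  move: (iNp); rewrite iNpE => /andP[hN1 h56].
  apply: (nonpriority_absurd u_gt0 v_ge0 v_ord v_irr eta_ge0 eta_le1 one_eq v_norm uRB sRB v1 E1 sz1
    st1i E2 sz2 (stop2 _ iA2) iA2 iN (sh i iA) (red i iA) stk hN1); lra.
have x180 g : g \in goodsM m -> v i g / u <= 180.
  move=> gM; have := x_le_s0 u_gt0 v_ge0 v_ord iN gM.
  by have [] := irr_s0 u_gt0 v_ge0 v_ord v_irr iN; lra.
have [p10 ph1] := pr1 i iA1 iNp.
have [ph2 ph2b p21] := phase2_prio u_gt0 v_ge0 v_ord H2 v1 iA2 iNp x180.
(* The ratio in the hypothesis on the size of N^1_1 equals [1 - eta / 60]. *)
have few : 60 * (prios Np (agentsN n))%:R < eta * n%:R.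
  have := prios_count (fun i => inN1 v n m i && (1 / 4 - 5 * delta <= ival v m i [:: (2 * n).+1]%N))
    (agentsN n); rewrite -/(N11 v n m delta) -/Np size_iota => /(congr1 (fun k => k%:R : R)).
  rewrite natrD => Ep.
  have K0 : 0 < 1 / 4 + delta / 3 by lra.
  move: hN11; rewrite ltr_pdivrMr // => hlt.
  rewrite -(ltr_pM2l u_gt0) [u * (eta * _)]mulrA [u * eta]mulrC etaE /u.
  have {Ep} -> : (prios Np (agentsN n))%:R = n%:R - (size Np)%:R :> R by lra.
  lra.
rewrite size_iota sz1 in ph1.
apply: (priority_absurd u_gt0 v_ge0 v_ord v_irr eta_ge0 eta_le1 one_eq v_norm uRB sRB v1 E1 sz1
    E2 sz2 (stop2 _ iA2) iA2 iN (sh i iA) (red i iA) stk few p10 p21 ph1 ph2 ph2b).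
by rewrite -iNpE.
Qed.
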